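(* Let $S,\Theta,(E,\mathcal{E},Q),f,G,\bar f$ be as in the context. Let $\varphi:S\times E\times\Theta\to S$ satisfy (A.1), (A.3), (A.4) and (A.5), and let $\varphi^j:S\times E\times\Theta\to S$, $j\ge1$, be functions each of which satisfies (A.1) and (A.3) (all listed in the context). Let $\theta^0$ be the unique minimizer of $G(E_\theta(f),\bar f)$ over $\theta\in\Theta$. Assume that the functions $\varphi^j(\cdot,\cdot,\theta)$ converge to $\varphi(\cdot,\cdot,\theta)$ uniformly over $\theta\in\Theta$ in the metric $d$ of the context, i.e. $\sup_{\theta\in\Theta}d(\varphi^j(\cdot,\cdot,\theta),\varphi(\cdot,\cdot,\theta))\to0$ as $j\to\infty$. For each $j$ let $\theta^j$ be an optimal solution of $$\min_{\theta\in\Theta}G\left(\int f(s)\,\mu_\theta^j(ds),\bar f\right),$$ where $\mu^j_\theta$ denotes an invariant probability of $\varphi^j(\cdot,\cdot,\theta)$ (not necessarily unique) and the problem is understood as a minimization over the correspondence of invariant probabilities: $\theta^j\in\Theta$ is an optimal solution if there is an invariant probability $\mu$ of $\varphi^j(\cdot,\cdot,\theta^j)$ such that $G(\int f\,d\mu,\bar f)\le G(\int f\,d\mu',\bar f)$ for all $\theta'\in\Theta$ and all invariant probabilities $\mu'$ of $\varphi^j(\cdot,\cdot,\theta')$. Then every such sequence $\{\theta^j\}_{j\ge1}$ converges to $\theta^0$.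
   Context: Setting. $S=\{s\in\mathbb{R}^k : a_i\le s_i\le b_i,\ i=1,\dots,k\}$ with constants $a_i<b_i$, with Borel $\sigma$-algebra $\mathcal{S}$; $\geq$ is the coordinatewise partial order on Euclidean space. $(E,\mathcal{E})$ is a measurable space with a probability law $Q$ (the law of the i.i.d. shocks $\varepsilon$). $\Theta\subset\mathbb{R}^l$ is compact, with its Borel $\sigma$-algebra. A function $h$ on $S$ is increasing if $h(s)\ge h(s')$ whenever $s\ge s'$. For a measurable map $\psi:S\times E\to S$, a Borel probability $\mu$ on $S$ is an invariant probability of $\psi$ if $\mu(A)=\int_S Q(\{\varepsilon:\psi(s,\varepsilon)\in A\})\,\mu(ds)$ for all $A\in\mathcal{S}$. Let $e=(1,\dots,1)\in\mathbb{R}^k$ and let $\mathrm{proj}_S$ be the nearest-point (Euclidean) projection of $\mathbb{R}^k$ onto $S$. For $\kappa>0$ and a function $\varphi:S\times E\times\Theta\to S$ define $$\varphi^\kappa(s,\varepsilon,\theta)=\mathrm{proj}_S[\varphi(\mathrm{proj}_S[s+\kappa e],\varepsilon,\theta)+\kappa e],\qquad \varphi_\kappa(s,\varepsilon,\theta)=\mathrm{proj}_S[\varphi(\mathrm{proj}_S[s-\kappa e],\varepsilon,\theta)-\kappa e]$$ (not to be confused with the approximating sequence $\varphi^j$, which is indexed by integers $j$). For functions on $S\times E$, $\psi\ge\psi'$ means $\psi(s,\varepsilon)\ge\psi'(s,\varepsilon)$ for all $(s,\varepsilon)$. Assumptions on a function $\varphi:S\times E\times\Theta\to S$: (A.1)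 $\varphi$ is measurable with respect to the product $\sigma$-algebra on $S\times E\times\Theta$. (A.3) For every fixed $\theta$ and every continuous $g:S\to\mathbb{R}$, $\int g(\varphi(s_i,\varepsilon,\theta))Q(d\varepsilon)\to\int g(\varphi(s,\varepsilon,\theta))Q(d\varepsilon)$ whenever $s_i\to s$ in $S$. (A.4) For every $\theta\in\Theta$ and $\kappa>0$, the set $\{\theta'\in\Theta:\varphi^\kappa(\cdot,\cdot,\theta)\ge\varphi(\cdot,\cdot,\theta')\ge\varphi_\kappa(\cdot,\cdot,\theta)\}$ contains an open neighborhood $V_\kappa(\theta)$ of $\theta$ (relative to $\Theta$). (A.5) For every $\theta\in\Theta$, the mapping $\varphi(\cdot,\cdot,\theta)$ has a unique invariant probability $\mu_\theta$. Metric. For measurable $\psi,\tilde\psi:S\times E\to S$, $$d(\psi,\tilde\psi)=\sup_{s\in S}\int\|\psi(s,\varepsilon)-\tilde\psi(s,\varepsilon)\|\,Q(d\varepsilon),$$ where $\|\cdot\|$ is the max norm on $\mathbb{R}^k$. Objective. $f:S\to\mathbb{R}^p$ is continuous and increasing; $E_\theta(f)=\int f(s)\,\mu_\theta(ds)$, where $\mu_\theta$ is the unique invariant probability of $\varphi(\cdot,\cdot,\theta)$; $\bar f\in\mathbb{R}^p$ is a fixed vector (the expected value of $f$ under the invariant distribution of the data generating process); $G:\mathbb{R}^p\times\mathbb{R}^p\to\mathbb{R}$ is continuous; $\theta^0=\arg\min_{\theta\in\Theta}G(E_\theta(f),\bar f)$ is assumed to be unique. *)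

(* Defs.v *)
(* Vectors of R^n are row vectors 'rV[R]_n, whose norm `|x| is the max norm. *)
From mathcomp Require Export all_boot all_order all_algebra.
From mathcomp Require Export all_classical all_reals all_analysis.

Set Implicit Arguments.
Unset Strict Implicit.
Unset Printing Implicit Defensive.

Export Order.TTheory GRing.Theory Num.Theory.
Export numFieldNormedType.Exports.

Global Open Scope classical_set_scope.
Global Open Scope ring_scope.

(* 'rV[R]_n has no measurable structure in the library: [borel R n] is the same
   carrier, equipped with the sigma-algebra generated by the open sets. *)
Definition borel (R : realType) (n : nat) :=
  g_sigma_algebraType (@open 'rV[R]_n).

Definition vle (R : realType) (n : nat) (x y : 'rV[R]_n) : Prop :=
  forall i, x 0 i <= y 0 i.

Definition box (R : realType) (n : nat) (a b : 'rV[R]_n) : set 'rV[R]_n :=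
  [set s | forall i, a 0 i <= s 0 i <= b 0 i].

Definition increasing_on (R : realType) (n p : nat) (S : set 'rV[R]_n)
    (h : 'rV[R]_n -> 'rV[R]_p) : Prop :=
  forall s s', S s -> S s' -> vle s' s -> vle (h s') (h s).

Definition euclidean_norm (R : realType) (n : nat) (x : 'rV[R]_n) : R :=
  Num.sqrt (\sum_i x 0 i ^+ 2).

Definition nearest_point (R : realType) (n : nat) (S : set 'rV[R]_n)
    (x y : 'rV[R]_n) : Prop :=
  S y /\ forall z, S z -> euclidean_norm (x - y) <= euclidean_norm (x - z).

Definition proj_on (R : realType) (n : nat) (S : set 'rV[R]_n)
    (x : 'rV[R]_n) : 'rV[R]_n :=
  xget x [set y | nearest_point S x y].

(* A function S x E x Theta -> S is a function defined on the ambient spaces,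
   used only at points of S and Theta, where its values are in S; likewise for
   functions S x E -> S and for f on S. *)
Definition maps_into (R : realType) (k l : nat) (E : Type)
    (S : set 'rV[R]_k) (Theta : set 'rV[R]_l)
    (phi : 'rV[R]_k -> E -> 'rV[R]_l -> 'rV[R]_k) : Prop :=
  forall s e theta, S s -> Theta theta -> S (phi s e theta).

Definition phi_up (R : realType) (k l : nat) (E : Type) (S : set 'rV[R]_k)
    (phi : 'rV[R]_k -> E -> 'rV[R]_l -> 'rV[R]_k) (kappa : R) :
    'rV[R]_k -> E -> 'rV[R]_l -> 'rV[R]_k :=
  fun s e theta =>
    proj_on S (phi (proj_on S (s + const_mx kappa)) e theta + const_mx kappa).

Definition phi_down (R : realType) (k l : nat) (E : Type) (S : set 'rV[R]_k)
    (phi : 'rV[R]_k -> E -> 'rV[R]_l -> 'rV[R]_k) (kappa : R) :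
    'rV[R]_k -> E -> 'rV[R]_l -> 'rV[R]_k :=
  fun s e theta =>
    proj_on S (phi (proj_on S (s - const_mx kappa)) e theta - const_mx kappa).

Definition fun_le (R : realType) (k : nat) (E : Type) (S : set 'rV[R]_k)
    (psi psi' : 'rV[R]_k -> E -> 'rV[R]_k) : Prop :=
  forall s e, S s -> vle (psi s e) (psi' s e).

(* A Borel probability on the (Borel) set S is a Borel probability on R^k giving
   mass 1 to S; the Borel subsets of S are the Borel sets of R^k included
   in S. *)
Definition invariant_probability (R : realType) (k : nat)
    (d : measure_display) (E : measurableType d) (Q : probability E R)
    (S : set 'rV[R]_k) (psi : 'rV[R]_k -> E -> 'rV[R]_k)
    (mu : probability (borel R k) R) : Prop :=
  mu S = 1%E /\
  forall A : set (borel R k), measurable A -> A `<=` S ->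
    mu A = (\int[mu]_(s in S) Q [set e | A (psi s e)])%E.

Definition assumption_A1 (R : realType) (k l : nat)
    (d : measure_display) (E : measurableType d)
    (S : set 'rV[R]_k) (Theta : set 'rV[R]_l)
    (phi : 'rV[R]_k -> E -> 'rV[R]_l -> 'rV[R]_k) : Prop :=
  measurable_fun (S `*` [set: E] `*` Theta : set (borel R k * E * borel R l))
    (fun x : borel R k * E * borel R l => phi x.1.1 x.1.2 x.2 : borel R k).

Definition assumption_A3 (R : realType) (k l : nat)
    (d : measure_display) (E : measurableType d) (Q : probability E R)
    (S : set 'rV[R]_k) (Theta : set 'rV[R]_l)
    (phi : 'rV[R]_k -> E -> 'rV[R]_l -> 'rV[R]_k) : Prop :=
  forall theta, Theta theta ->
  forall g : 'rV[R]_k -> R, {within S, continuous g} ->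
  forall (u : nat -> 'rV[R]_k) (s : 'rV[R]_k),
    (forall i, S (u i)) -> S s -> u i @[i --> \oo] --> s ->
    (\int[Q]_e g (phi (u i) e theta)) @[i --> \oo]
      --> \int[Q]_e g (phi s e theta).

Definition assumption_A4 (R : realType) (k l : nat) (E : Type)
    (S : set 'rV[R]_k) (Theta : set 'rV[R]_l)
    (phi : 'rV[R]_k -> E -> 'rV[R]_l -> 'rV[R]_k) : Prop :=
  forall theta, Theta theta -> forall kappa : R, 0 < kappa ->
  exists V : set 'rV[R]_l, [/\ open V, V theta &
    V `&` Theta `<=` [set theta' | Theta theta' /\
      fun_le S (fun s e => phi s e theta')
               (fun s e => phi_up S phi kappa s e theta) /\
      fun_le S (fun s e => phi_down S phi kappa s e theta)
               (fun s e => phi s e theta')]].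

(* Uniqueness is equality on measurable sets: the library leaves the value of a
   measure on other sets unconstrained, so that [exists!] would be too strong. *)
Definition assumption_A5 (R : realType) (k l : nat)
    (d : measure_display) (E : measurableType d) (Q : probability E R)
    (S : set 'rV[R]_k) (Theta : set 'rV[R]_l)
    (phi : 'rV[R]_k -> E -> 'rV[R]_l -> 'rV[R]_k) : Prop :=
  forall theta, Theta theta ->
  exists mu : probability (borel R k) R,
    invariant_probability Q S (fun s e => phi s e theta) mu /\
    forall nu : probability (borel R k) R,
      invariant_probability Q S (fun s e => phi s e theta) nu ->
      forall A : set (borel R k), measurable A -> nu A = mu A.

Definition dist_fun (R : realType) (k : nat)
    (d : measure_display) (E : measurableType d) (Q : probability E R)
    (S : set 'rV[R]_k) (psi psi' : 'rV[R]_k -> E -> 'rV[R]_k) : \bar R :=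
  ereal_sup [set (\int[Q]_e `|psi s e - psi' s e|%:E)%E | s in S].

Definition vintegral (R : realType) (k p : nat) (S : set 'rV[R]_k)
    (mu : probability (borel R k) R) (f : 'rV[R]_k -> 'rV[R]_p) : 'rV[R]_p :=
  \row_i \int[mu]_(s in S) f s 0 i.

Definition is_minimizer (R : realType) (T : Type) (D : set T) (J : T -> R)
    (x : T) : Prop :=
  D x /\ forall y, D y -> J x <= J y.

Definition is_unique_minimizer (R : realType) (T : Type) (D : set T)
    (J : T -> R) (x : T) : Prop :=
  is_minimizer D J x /\ forall y, is_minimizer D J y -> y = x.

Definition optimal_solution (R : realType) (k l p : nat)
    (d : measure_display) (E : measurableType d) (Q : probability E R)
    (S : set 'rV[R]_k) (Theta : set 'rV[R]_l)
    (f : 'rV[R]_k -> 'rV[R]_p) (G : 'rV[R]_p -> 'rV[R]_p -> R)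
    (fbar : 'rV[R]_p)
    (phi : 'rV[R]_k -> E -> 'rV[R]_l -> 'rV[R]_k) (theta : 'rV[R]_l) : Prop :=
  Theta theta /\
  exists mu : probability (borel R k) R,
    invariant_probability Q S (fun s e => phi s e theta) mu /\
    forall (theta' : 'rV[R]_l) (mu' : probability (borel R k) R),
      Theta theta' ->
      invariant_probability Q S (fun s e => phi s e theta') mu' ->
      G (vintegral S mu f) fbar <= G (vintegral S mu' f) fbar.

(* Main.v *)
(* Weak limits of invariant probabilities mu_j of phi^j(., ., theta_j), with
   theta_j -> theta, are invariant for phi(., ., theta).  For an increasing
   M-Lipschitz g, (A.4) and the uniform convergence bound the integral of g
   with respect to mu_j by that of Tg(s + kappa) plus 2 M kappa, where
   Tg(s) = int g(phi(s, e, theta)) Q(de) is continuous by (A.3), and likewise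
   from below with -kappa; letting j -> oo and then kappa -> 0, the limit mu
   satisfies int g dmu = int Tg dmu.  Every Lipschitz function is a difference
   of increasing ones, so mu is invariant, hence mu = mu_theta by (A.5).
   Applied to the optimal (theta_j, mu_j), and to theta_j := theta0 with
   invariant probabilities of phi^j(., ., theta0), which exist by
   Krylov-Bogoliubov, this shows that every cluster point of theta_j minimizes
   the limit problem.  Subsequences are replaced by ultrafilters on nat: along
   an ultrafilter the integrals of continuous functions always converge, and
   the limit functional is a measure by the Riesz representation theorem. *)
Require Import Defs.
From HB Require Import structures.
From mathcomp Require Import ring lra measurable_realfun.

Set Implicit Arguments.
Unset Strict Implicit.
Unset Printing Implicit Defensive.

(** * Riesz representation on a compact set *)

(** Both sides are the unordered sum of a nonnegative family over [nat * nat], which depends neither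
    on the enumeration nor on the grouping into rows. *)
Lemma nneseries_pairs (R : realType) (f : nat -> nat * nat)
    (a : nat -> nat -> \bar R) :
  set_bij [set: nat] [set: nat * nat] f -> (forall i j, (0 <= a i j)%E) ->
  (\sum_(n <oo) a (f n).1 (f n).2 = \sum_(i <oo) \sum_(j <oo) a i j)%E.
Proof.
move=> bf a0.
rewrite nneseries_esumT//.
rewrite -(@reindex_esum R _ _ [set: nat] [set: nat * nat] f
  (fun p => a p.1 p.2))//.
rewrite [RHS]nneseries_esumT; last by move=> i; exact: nneseries_ge0.
under [RHS]eq_esum do rewrite nneseries_esumT//.
rewrite esum_esum//; congr esum.
by apply/seteqP; split.
Qed.

Lemma continuous_measurable_borel (R : realType) (T : ptopologicalType)
    (g : T -> R) : continuous g ->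
  measurable_fun [set: g_sigma_algebraType (@open T)] g.
Proof.
move=> /continuousP cg.
apply: (measurability _ (RGenOpens.measurableE R)).
move=> _ [_ [a [b ->] <-]]; rewrite setTI; apply: sub_sigma_algebra.
exact/cg/interval_open.
Qed.

Lemma bounded_continuous (R : realType) (T : topologicalType) (S : set T)
    (g : T -> R) : compact S -> continuous g ->
  exists2 M, 0 < M & forall x, S x -> `|g x| <= M.
Proof.
move=> cS cg.
have /compact_bounded[M [_ SM]] : compact (g @` S).
  by apply: continuous_compact => //; exact: continuous_subspaceT.
exists (`|M| + 1); first by rewrite ltr_wpDl.
move=> x Sx; apply: SM; last by exists x.
by rewrite (le_lt_trans (ler_norm _))// ltrDl.
Qed.

Lemma closed_measurable_borel (T : ptopologicalType)
    (A : set (g_sigma_algebraType (@open T))) :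
  closed (A : set T) -> measurable A.
Proof.
move=> cA; rewrite -[A]setCK; apply: measurableC; apply: sub_sigma_algebra.
exact: closed_openC cA.
Qed.

Lemma integrable_continuous (R : realType) (T : ptopologicalType)
    (S : set T) (mu : {finite_measure set (g_sigma_algebraType (@open T)) ->
      \bar R})
    (g : T -> R) :
  compact S -> closed S -> continuous g -> mu.-integrable S (EFin \o g).
Proof.
move=> compactS closedS cg; apply: measurable_bounded_integrable.
- exact: closed_measurable_borel.
- by rewrite ltey_eq fin_num_measure//; exact: closed_measurable_borel.
- by apply: measurable_funTS; exact: continuous_measurable_borel.
- have [M M0 gM] := bounded_continuous compactS cg.
  exists M; split; first exact: num_real.
  by move=> N MN x Sx; apply: (le_trans (gM x Sx)); exact: ltW.
Qed.

Lemma continuous_addf (R : realType) (T : topologicalType) (g h : T -> R) :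
  continuous g -> continuous h -> continuous (g \+ h).
Proof. by move=> cg ch x; apply: cvgD; [exact: cg|exact: ch]. Qed.

Lemma continuous_mull (R : realType) (T : topologicalType) (c : R)
    (g : T -> R) : continuous g -> continuous (fun x => c * g x).
Proof. by move=> cg x; apply: cvgM; [exact: cvg_cst|exact: cg]. Qed.

(** A normalized positive linear functional on C([S]), acting on functions defined on all of [T].
    Positivity is tested on [S] alone, so that on continuous functions [L g] depends only on the
    restriction of [g] to [S], see [eq_pfunct]. *)
Definition positive_functional (R : realType) (T : topologicalType) (S : set T)
    (L : (T -> R) -> R) : Prop :=
  [/\ forall g h : T -> R, continuous g -> continuous h -> L (g \+ h)%R = L g +
    L h,
      forall (c : R) (g : T -> R), continuous g -> L (fun x => c * g x) = c * L
        g,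
      forall g : T -> R, continuous g -> (forall x, S x -> 0 <= g x) -> 0 <= L
        g &
      L (fun=> 1) = 1].

Section positive_functional_theory.
Context (R : realType) (T : topologicalType) (S : set T) (L : (T -> R) -> R).
Hypothesis Lpos : positive_functional S L.

Lemma pfunctD (g h : T -> R) : continuous g -> continuous h ->
  L (g \+ h) = L g + L h.
Proof. by have [+ _ _ _] := Lpos; exact. Qed.

Lemma pfunctZ (c : R) (g : T -> R) : continuous g ->
  L (fun x => c * g x) = c * L g.
Proof. by have [_ + _ _] := Lpos; exact. Qed.

Lemma pfunct_ge0 (g : T -> R) : continuous g ->
  (forall x, S x -> 0 <= g x) -> 0 <= L g.
Proof. by have [_ _ + _] := Lpos; exact. Qed.

Lemma pfunct_cst (c : R) : L (fun=> c) = c.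
Proof.
have [_ _ _ L1] := Lpos.
rewrite -[RHS]mulr1 -L1 -pfunctZ; last by move=> x; exact: cvg_cst.
by congr L; apply/funext => x; rewrite mulr1.
Qed.

Lemma pfunctB (g h : T -> R) : continuous g -> continuous h ->
  L (g \- h) = L g - L h.
Proof.
move=> cg ch.
have -> : g \- h = g \+ (fun x => -1 * h x).
  by apply/funext => x /=; rewrite mulN1r.
rewrite pfunctD//; last by move=> x; apply: cvgM; [exact: cvg_cst|exact: ch].
by rewrite pfunctZ// mulN1r.
Qed.

Lemma le_pfunct (g h : T -> R) : continuous g -> continuous h ->
  (forall x, S x -> g x <= h x) -> L g <= L h.
Proof.
move=> cg ch gh; rewrite -subr_ge0 -pfunctB//; apply: pfunct_ge0.
  by move=> x; apply: cvgB; [exact: ch|exact: cg].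
by move=> x Sx /=; rewrite subr_ge0 gh.
Qed.

Lemma eq_pfunct (g h : T -> R) : continuous g -> continuous h ->
  (forall x, S x -> g x = h x) -> L g = L h.
Proof.
by move=> cg ch gh; apply/eqP; rewrite eq_le !le_pfunct// => x Sx; rewrite gh.
Qed.

Lemma norm_pfunct_le (g : T -> R) (M : R) : continuous g ->
  (forall x, S x -> `|g x| <= M) -> `|L g| <= M.
Proof.
move=> cg gM; rewrite ler_norml; apply/andP; split.
  rewrite -(pfunct_cst (- M)); apply: le_pfunct => [x|//|x /gM].
    exact: cvg_cst.
  by rewrite ler_norml => /andP[].
rewrite -(pfunct_cst M); apply: le_pfunct => [//|x|x /gM].
  exact: cvg_cst.
by rewrite ler_norml => /andP[].
Qed.

Lemma pfunct_sum (g : nat -> T -> R) n : (forall i, continuous (g i)) ->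
  L (fun x => \sum_(i < n) g i x) = \sum_(i < n) L (g i).
Proof.
move=> cg; elim: n => [|n ih].
  rewrite big_ord0 -[RHS](pfunct_cst 0); congr L; apply/funext => x.
  by rewrite big_ord0.
rewrite big_ord_recr/= -ih -pfunctD//; last first.
  by apply: continuous_big => //; exact: add_continuous.
by congr L; apply/funext => x; rewrite big_ord_recr.
Qed.

End positive_functional_theory.

Lemma positive_functional_integral (R : realType) (T : ptopologicalType)
    (S : set T) (mu : probability (g_sigma_algebraType (@open T)) R) :
  compact S -> closed S -> mu S = 1%E ->
  positive_functional S (fun g => \int[mu]_(x in S) g x).
Proof.
move=> compactS closedS muS.
have mS : measurable (S : set (g_sigma_algebraType (@open T))).
  exact: closed_measurable_borel.
split.
- move=> g h cg ch; rewrite -RintegralD//; exact: integrable_continuous.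
- by move=> c g cg; rewrite RintegralZl//; exact: integrable_continuous.
- by move=> g cg g0; exact: Rintegral_ge0.
- by rewrite Rintegral_cst// mul1r [X in fine X]muS.
Qed.

Section Riesz.
Context (R : realType) (T : ptopologicalType) (S : set T) (L : (T -> R) -> R).
Hypothesis compactS : compact S.
(** This plays the part of Urysohn's lemma; in a normed space the distance to the complement of [O]
    provides [u]. *)
Hypothesis cozero : forall O : set T, open O ->
  exists2 u : T -> R, continuous u & forall x, 0 <= u x /\ (O x <-> 0 < u x).
Hypothesis Lpos : positive_functional S L.

Let LD := pfunctD Lpos.
Let LZ := pfunctZ Lpos.
Let L_ge0 := pfunct_ge0 Lpos.
Let L_sum := pfunct_sum Lpos.

Let cst_cont (c : R) : continuous (fun _ : T => c).
Proof. by move=> x; exact: cvg_cst. Qed.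

Let L0 : L (fun=> 0) = 0 := pfunct_cst Lpos 0.
Let L1 : L (fun=> 1) = 1 := pfunct_cst Lpos 1.

(* Covers by functions rather than by sets: for an open O = {u > 0} and
   h_m = min(1, m u), a cover (g_n) of X splits into covers
   (g_n (h_(m+1) - h_m)) of X meet O and (g_n (1 - h_m)) of X minus O, so that
   O is Caratheodory measurable. *)
Let riesz_cover (A : set T) : set ((T -> R)^nat) := [set g : (T -> R)^nat |
  [/\ forall n, continuous (g n), forall n x, S x -> 0 <= g n x &
    forall x, S x -> A x -> (1 <= \sum_(n <oo) (g n x)%:E)%E]].

Let riesz_outer (A : set T) : \bar R :=
  ereal_inf [set (\sum_(n <oo) (L (g n))%:E)%E | g in riesz_cover A].

(** The double family is enumerated as one sequence through a bijection of [nat] with [nat * nat],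
    which makes it an element of [riesz_cover A]. *)
Let double_cover (A : set T) (g : nat -> nat -> T -> R) :
  (forall n m, continuous (g n m)) -> (forall n m x, S x -> 0 <= g n m x) ->
  (forall x, S x -> A x -> (1 <= \sum_(n <oo) \sum_(m <oo) (g n m x)%:E)%E) ->
  (riesz_outer A <= \sum_(n <oo) \sum_(m <oo) (L (g n m))%:E)%E.
Proof.
move=> cg g0 gA.
have /card_esym/ppcard_eqP[f] := card_nat2.
have bf : set_bij [set: nat] [set: nat * nat] f by exact: bij.
rewrite -(nneseries_pairs (a := fun i j => (L (g i j))%:E) bf)//; last first.
  by move=> i j; rewrite lee_fin L_ge0//; exact: g0.
apply: ereal_inf_lbound; exists (fun n => g (f n).1 (f n).2) => //.
split => // [n x Sx|x Sx Ax]; first exact: g0.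
rewrite (nneseries_pairs (a := fun i j => (g i j x)%:E) bf)//.
  exact: gA.
by move=> i j; rewrite lee_fin g0.
Qed.

Let riesz_outer_ge0 A : (0 <= riesz_outer A)%E.
Proof.
apply: le_ereal_inf_tmp => _ [g [cg g0 _] <-].
by apply: nneseries_ge0 => n _ _; rewrite lee_fin L_ge0//; exact: g0.
Qed.

Let riesz_outer0 : riesz_outer set0 = 0%E.
Proof.
apply/eqP; rewrite eq_le riesz_outer_ge0 andbT.
apply: ereal_inf_lbound; exists (fun _ _ => 0).
  by split.
by apply: eseries0 => n _ _; rewrite L0.
Qed.

Let le_riesz_outer : {homo riesz_outer : A B / A `<=` B >-> (A <= B)%E}.
Proof.
move=> A B AB; apply/ereal_inf_le_tmp => _ [g [cg g0 gB] <-].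
by exists g => //; split => // x Sx /AB; exact: gB.
Qed.

Let riesz_outer_sigma_subadditive : sigma_subadditive riesz_outer.
Proof.
move=> A; have [[i ioo]|] := pselect (exists i, riesz_outer (A i) = +oo%E).
  rewrite (eseries_pinfty _ _ ioo) ?leey// => n _.
  by rewrite -ltNye (lt_le_trans _ (riesz_outer_ge0 _)).
rewrite -forallNE => Aoo.
apply/lee_addgt0Pr => e e0.
rewrite (le_trans _ (epsilon_trick _ _ _))//; last exact: ltW.
(* Each [A n] gets a cover whose cost is within e / 2^(n+1) of the infimum; these errors sum to
   [e]. *)
have [G PG] : {G : nat -> (T -> R)^nat & forall n, riesz_cover (A n) (G n) /\
    (\sum_(k <oo) (L (G n k))%:E <=
      riesz_outer (A n) + (e / (2 ^ n.+1)%:R)%:E)%E}.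
  apply: (@choice _ _ (fun n g => riesz_cover (A n) g /\
    (\sum_(k <oo) (L (g k))%:E <=
      riesz_outer (A n) + (e / (2 ^ n.+1)%:R)%:E)%E)) => n.
  have en1 : 0 < e / (2 ^ n.+1)%:R by rewrite divr_gt0// ltr0n expn_gt0.
  have /(lb_ereal_inf_adherent en1)[_ [g cg <-] ltg] :
      riesz_outer (A n) \is a fin_num.
    by rewrite ge0_fin_numE// ltey; apply/eqP; exact: Aoo.
  by exists g; split => //; exact: ltW.
apply: (@le_trans _ _ (\sum_(n <oo) \sum_(k <oo) (L (G n k))%:E)%E).
  apply: double_cover => [n m|n m x Sx|x Sx [n _ Anx]].
  - by have [[]] := PG n.
  - by have [[_ + _ _]] := PG n; exact.
  - have G0 k m : (0 <= (G k m x)%:E)%E.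
      by rewrite lee_fin; have [[_ + _ _]] := PG k; exact.
    have [[_ _ /(_ x Sx Anx) h] _] := PG n.
    rewrite (le_trans h)// [leRHS](nneseriesD1 (n:=n))//; last first.
      by move=> k _; exact: nneseries_ge0.
    by rewrite leeDl//; apply: nneseries_ge0 => k _ _; exact: nneseries_ge0.
apply: lee_nneseries => n _; last by have [] := PG n.
move=> _; apply: nneseries_ge0 => k _ _; rewrite lee_fin.
have [[cG G0 _] _] := PG n; apply: L_ge0; [exact: cG|exact: G0].
Qed.

Let riesz_outer_le (A : set T) (g : T -> R) : continuous g ->
  (forall x, S x -> 0 <= g x) -> (forall x, S x -> A x -> 1 <= g x) ->
  (riesz_outer A <= (L g)%:E)%E.
Proof.
move=> cg g0 gA; pose G (n : nat) := if n is 0 then g else fun=> 0.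
(* [a] is arbitrary because the identity serves twice: for [L], in the cost of the cover, and for
   evaluation at [x], in the covering condition. *)
have sumG (a : (T -> R) -> R) : a (fun=> 0) = 0 -> 0 <= a g ->
    (\sum_(n <oo) (a (G n))%:E = (a g)%:E)%E.
  move=> a0 ag; rewrite (nneseriesD1 (n:=0))//=; last by case=> [|k] _;
    rewrite lee_fin// a0.
  by rewrite eseries0 ?adde0// => -[//|k] _ _; rewrite a0.
rewrite -sumG//; last exact: L_ge0.
apply: ereal_inf_lbound; exists G => //; split.
- by move=> [|n]; [exact: cg|exact: cst_cont].
- by move=> [|n] x Sx //=; exact: g0.
- by move=> x Sx Ax; rewrite (sumG (fun h => h x))// ?lee_fin ?gA ?g0.
Qed.

(** A Dini argument: the partial sums of a cover are continuous, nondecreasing on [S], and pass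
    [1 - e] at each point, so by compactness a single partial sum exceeds [1 - e] on all of [S].
    Finite additivity of [L] then applies to it. *)
Let riesz_outer_ge1 : (1 <= riesz_outer S)%E.
Proof.
apply: le_ereal_inf_tmp => _ [g [cg g0 gS] <-].
apply/lee_addgt0Pr => e e0.
have /near_covering_withinP cov : near_covering S by
  exact/compact_near_coveringP.
have [|N _ /(_ N (leqnn _)) SN] :=
    cov nat \oo (fun n x => 1 - e < \sum_(k < n) g k x) _.
  move=> x Sx.
  have [N hN] : exists N, 1 - e < \sum_(k < N) g k x.
    apply: contrapT => /forallNP h.
    have : (1 <= (1 - e)%:E)%E.
      apply: (le_trans (gS x Sx Sx)); apply: lime_le.
        by apply: is_cvg_nneseries => n _ _; rewrite lee_fin g0.
      apply: nearW => n; rewrite big_mkord sumEFin lee_fin leNgt.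
      exact/negP/h.
    by rewrite lee_fin; lra.
  have cN : continuous (fun x => \sum_(k < N) g k x).
    by apply: continuous_big => //; exact: add_continuous.
  near=> y n => Sy; apply: (@lt_le_trans _ _ (\sum_(k < N) g k y)).
    by near: y; apply: (cvgr_gt _ (cN x)).
  have Nn : (N <= n)%N by near: n; exact: nbhs_infty_ge.
  by rewrite -!(big_mkord xpredT (fun k => g k y)) (big_cat_nat (leq0n N)
    Nn)//= lerDl sumr_ge0// => k _; exact: g0.
apply: (@le_trans _ _ ((\sum_(k < N) L (g k))%:E + e%:E)%E); last first.
  rewrite leeD2r// -sumEFin -(big_mkord xpredT (fun k => (L (g k))%:E)).
  by apply: nneseries_lim_ge => n _ _; rewrite lee_fin L_ge0//; exact: g0.
rewrite -EFinD lee_fin -L_sum// -lerBlDr.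
have -> : 1 - e = L (fun=> (1 - e) * 1) by rewrite LZ// L1 mulr1.
apply: (le_pfunct Lpos) => [||x Sx]; first exact: cst_cont.
  by apply: continuous_big => //; exact: add_continuous.
by rewrite mulr1; exact/ltW/SN.
Unshelve. all: by end_near. Qed.

Let open_caratheodory (m : {outer_measure set T -> \bar R}) (O : set T) :
  m = riesz_outer :> (set T -> \bar R) -> open O -> m.-caratheodory O.
Proof.
move=> mE oO; apply: le_caratheodory_measurable => X; rewrite mE {mE m}.
apply: le_ereal_inf_tmp => _ [g [cg g0 gX] <-].
have Lg0 n : (0 <= (L (g n))%:E)%E by rewrite lee_fin L_ge0//; exact: g0.
set B := (\sum_(n <oo) (L (g n))%:E)%E.
have [->|Bfin] := eqVneq B +oo%E; first by rewrite leey.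
have {}Bfin : B \is a fin_num by rewrite ge0_fin_numE ?ltey// nneseries_ge0.
have [u cu u0] := cozero oO.
pose h (k : nat) (x : T) : R := Num.min 1 (k%:R * u x).
have ch k : continuous (h k).
  move=> x; apply: (@continuous_min R T (fun=> 1) (fun y => k%:R * u y));
    first exact: cvg_cst.
  by apply: cvgM; [exact: cvg_cst|exact: cu].
have h0 k x : 0 <= h k x.
  by rewrite /h le_min ler01/= mulr_ge0//; case: (u0 x).
have h1 k x : h k x <= 1 by rewrite /h ge_min lexx.
have hS k x : h k x <= h k.+1 x.
  rewrite /h le_min ge_min lexx/= ge_min; apply/orP; right.
  by rewrite ler_wpM2r ?ler_nat//; case: (u0 x).
have hM k (f : T -> R) : continuous f -> continuous (fun x => f x * h k x).
  by move=> cf x; apply: cvgM; [exact: cf|exact: ch].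
have ga k : (riesz_outer (X `&` ~` O) <= \sum_(n <oo) (L (fun x => g n x * (1 -
  h k x)))%:E)%E.
  apply: ereal_inf_lbound; exists (fun n x => g n x * (1 - h k x)) => //; split.
  - move=> n x; apply: cvgM; first exact: cg.
    by apply: cvgB; [exact: cvg_cst|exact: ch].
  - by move=> n x Sx; rewrite mulr_ge0 ?g0// subr_ge0.
  - move=> x Sx [Xx Ox].
    have ux0 : u x = 0.
      have [uge0 uO] := u0 x; apply/eqP; rewrite eq_le uge0 andbT leNgt.
      by apply/negP => /uO.
    have -> : h k x = 0 by rewrite /h ux0 mulr0 min_r.
    by under eq_eseriesr do rewrite subr0 mulr1; exact: gX.
have gb k : (\sum_(n <oo) (L (fun x => g n x * h k x))%:E <= B - riesz_outer (X
  `&` ~` O))%E.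
  have LL n : L (g n) = L (fun x => g n x * (1 - h k x)) + L (fun x => g n x *
    h k x).
    rewrite -LD.
    - by congr L; apply/funext => x /=; ring.
    - move=> x; apply: cvgM; first exact: cg.
      by apply: cvgB; [exact: cvg_cst|exact: ch].
    - exact: hM.
  have L0a n : (0 <= (L (fun x => g n x * h k x))%:E)%E.
    by rewrite lee_fin L_ge0//; [exact: hM|move=> x Sx; rewrite mulr_ge0 ?g0].
  have L0b n : (0 <= (L (fun x => g n x * (1 - h k x)))%:E)%E.
    rewrite lee_fin L_ge0//.
      move=> x; apply: cvgM; first exact: cg.
      by apply: cvgB; [exact: cvg_cst|exact: ch].
    by move=> x Sx; rewrite mulr_ge0 ?g0// subr_ge0.
  have BE : B = (\sum_(n <oo) (L (fun x => g n x * (1 - h k x)))%:E +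
      \sum_(n <oo) (L (fun x => g n x * h k x))%:E)%E.
    by rewrite -nneseriesD//; apply: eq_eseriesr => n _; rewrite -EFinD -LL.
  have afin : riesz_outer (X `&` ~` O) \is a fin_num.
    rewrite ge0_fin_numE// (le_lt_trans (ga k))// ltey_eq; apply/orP; left.
    move: Bfin; rewrite BE fin_numD; by case/andP.
  by rewrite leeBrDr// BE addeC leeD2r.
(* [h 0] vanishes, so [ga] at index 0 bounds this outer measure by [B]; being finite, it can be
   moved to the other side. *)
have afin : riesz_outer (X `&` ~` O) \is a fin_num.
  rewrite ge0_fin_numE// (le_lt_trans (ga 0%N))//.
  rewrite (eq_eseriesr (g := fun n => (L (g n))%:E)) ?ltey_eq ?Bfin// => n _.
  by congr (L _)%:E; apply/funext => x; rewrite /h mul0r min_r// subr0 mulr1.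
rewrite -leeBrDr//.
pose d n k x := g n x * (h k.+1 x - h k x).
have cd n k : continuous (d n k).
  move=> x; apply: cvgM; first exact: cg.
  by apply: cvgB; exact: ch.
have d0 n k x : S x -> 0 <= d n k x.
  by move=> Sx; rewrite mulr_ge0 ?g0// subr_ge0.
have sumd n k x : \sum_(0 <= i < k) d n i x = g n x * h k x.
  rewrite /d -mulr_sumr telescope_sumr// {2}/h mul0r min_r// subr0//.
(* At a point [x] of [O] the partial sums of [d n k x] over [k] telescope to [g n x * h k x], which
   is [g n x] as soon as k >= 1 / u x. Hence the functions [d n k] cover [X] meet [O]. *)
apply: (@le_trans _ _ (\sum_(k <oo) \sum_(n <oo) (L (d n k))%:E)%E).
  apply: (double_cover (g := fun k n => d n k)) => [//|n m x Sx|x Sx [Xx Ox]].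
    exact: d0.
  rewrite nneseries_interchange; last by move=> i j; rewrite lee_fin d0.
  apply: (le_trans (gX x Sx Xx)); apply: lee_nneseries => n _.
    by rewrite lee_fin g0.
  have [uge0 [/(_ Ox) ux0 _]] := u0 x.
  pose k := (Num.trunc (u x)^-1).+1.
  have hk1 : h k x = 1.
    rewrite /h min_l// -ler_pdivrMr// mul1r ltW//; exact: truncnS_gt.
  rewrite -[g n x]mulr1 -hk1 -sumd -sumEFin.
  by apply: nneseries_lim_ge => m _ _; rewrite lee_fin d0.
have Ld0 n k : (0 <= (L (d n k))%:E)%E.
  by rewrite lee_fin L_ge0// => x; exact: d0.
(* It is enough to bound the partial sums in [k]. Exchanging the two sums and telescoping under [L]
   turns each into the series of the [L (g n * h k)], bounded in [gb]. *)
apply: lime_le.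
  by apply: is_cvg_nneseries => n _ _; apply: nneseries_ge0.
apply: nearW => k; rewrite -nneseries_sum_nat//.
rewrite (eq_eseriesr (g := fun n => (L (fun x => g n x * h k x))%:E))// => n _.
rewrite sumEFin big_mkord -L_sum//; congr (L _)%:E; apply/funext => x.
by rewrite -sumd big_mkord.
Qed.

(** The part of [t] that lies between the heights [n * e] and [n.+1 * e], as in the layer-cake
    decomposition. *)
Let layer (t e : R) (n : nat) : R := Num.min (Num.max (t - n%:R * e) 0) e.

Let sum_layer (t e : R) n : 0 <= t -> 0 < e ->
  \sum_(k < n) layer t e k = Num.min t (n%:R * e).
Proof.
move=> t0 e0; elim: n => [|n ih].
  by rewrite big_ord0 mul0r min_r.
rewrite big_ord_recr/= ih /layer -natr1 mulrDl mul1r.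
have [tn|tn] := leP t (n%:R * e).
- have -> : Num.max (t - n%:R * e) 0 = 0 by apply: max_r; lra.
  by rewrite !min_l ?addr0//; [lra|exact: ltW].
- have -> : Num.max (t - n%:R * e) 0 = t - n%:R * e by apply: max_l; lra.
  by have [h|h] := leP (t - n%:R * e) e; [rewrite min_l; lra|rewrite min_r;
    lra].
Qed.

Let layer_continuous (g : T -> R) e n : continuous g ->
  continuous (fun x => layer (g x) e n).
Proof.
move=> cg x; apply: (@continuous_min R T (fun y => Num.max (g y - n%:R * e) 0)
  (fun=> e)).
  apply: (@continuous_max R T (fun y => g y - n%:R * e) (fun=> 0)).
    by apply: cvgB; [exact: cg|exact: cvg_cst].
  exact: cvg_cst.
exact: cvg_cst.
Qed.

Let layer_ge0 (t e : R) n : 0 < e -> 0 <= layer t e n.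
Proof. by move=> e0; rewrite /layer le_min le_max lexx orbT ltW. Qed.

(** Open sets are Caratheodory measurable, so the outer measure restricts to a Borel measure; its
    integral is then compared with [L] layer by layer. *)
Lemma riesz_representation : closed S ->
  exists mu : probability (g_sigma_algebraType (@open T)) R,
    mu S = 1%E /\
    forall g : T -> R, continuous g -> \int[mu]_(x in S) g x = L g.
Proof.
move=> closedS.
pose isom := isOuterMeasure.Build R T riesz_outer riesz_outer0 riesz_outer_ge0
  le_riesz_outer riesz_outer_sigma_subadditive.
pose m : {outer_measure set T -> \bar R} := HB.pack riesz_outer isom.
have mE A : m A = riesz_outer A by [].
pose B := g_sigma_algebraType (@open T).
(* Measurability of the identity means that Borel sets are Caratheodory measurable; the image
   measure under it is the restriction to the Borel sets. *)
have mid : measurable_fun [set: caratheodory_type m] (id : _ -> B).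
  apply: (@measurability _ _ (caratheodory_type m) B setT id (@open T)) => //.
  by move=> _ [V oV <-]; rewrite setTI; exact: open_caratheodory oV.
have mT : m [set: T] = 1%E.
  rewrite mE; apply/eqP; rewrite eq_le; apply/andP; split; last first.
    by rewrite (le_trans riesz_outer_ge1)// le_riesz_outer.
  rewrite -L1; apply: riesz_outer_le => //; exact: cst_cont.
pose cm : {measure set (caratheodory_type m) -> \bar R} := m.
pose pm : probability (caratheodory_type m) R :=
  HB.pack (Measure.sort cm) (Measure_isProbability.Build _ _ _ cm mT).
pose X : {mfun caratheodory_type m >-> B} :=
  HB.pack (id : caratheodory_type m -> B) (isMeasurableFun.Build _ _ _ _ _ mid).
pose mu : probability B R := distribution pm X.
have muE A : mu A = riesz_outer A by [].
have muS : (mu S = 1)%E.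
  apply/eqP; rewrite eq_le probability_le1/=;
    last exact: closed_measurable_borel.
  exact: riesz_outer_ge1.
exists mu; split => //.
have Ipos := positive_functional_integral compactS closedS muS.
(* One inequality for functions nonnegative on [S] suffices: it is applied to [g + M] and to
   [M - g], where [M] bounds [|g|] on [S]. *)
suff key (g : T -> R) : continuous g -> (forall x, S x -> 0 <= g x) ->
    \int[mu]_(x in S) g x <= L g.
  move=> g cg; have [M M0 gM] := bounded_continuous compactS cg.
  have cst_M : continuous (fun _ : T => M) by exact: cst_cont.
  apply/eqP; rewrite eq_le; apply/andP; split.
    rewrite -(lerD2r (L (fun=> M))) -LD// {1}(pfunct_cst Lpos).
    rewrite -{1}(pfunct_cst Ipos M) -(pfunctD Ipos)//; apply: key.
      by move=> x; apply: cvgD; [exact: cg|exact: cvg_cst].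
    by move=> x /gM /=; rewrite ler_norml => /andP[? _]; lra.
  rewrite -(lerD2r (- L (fun=> M))) -lerN2 !opprD !opprK ![- _ + _]addrC.
  rewrite -(pfunctB Lpos)// {1}(pfunct_cst Lpos).
  rewrite -{1}(pfunct_cst Ipos M) -(pfunctB Ipos)//; apply: key.
    by move=> x; apply: cvgB; [exact: cvg_cst|exact: cg].
  by move=> x /gM /=; rewrite ler_norml => /andP[_ ?]; lra.
move=> cg g0; apply/ler_addgt0Pr => e e0.
have [M M0 gM] := bounded_continuous compactS cg.
(* With this choice the [n.+1] layers of height [e] reach the bound [M]. *)
pose n := (Num.trunc (M / e)).+1.
have Mn : M <= n.+1%:R * e.
  rewrite -ler_pdivrMr// (le_trans (ltW (truncnS_gt _)))// ler_nat.
  exact: leqnSn.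
have gE : {in S, g =1 fun x => \sum_(k < n.+1) layer (g x) e k}.
  move=> x /[!inE] Sx; rewrite sum_layer ?g0// min_l// (le_trans _ Mn)//.
  by rewrite (le_trans (ler_norm _))// gM.
have cl k : continuous (fun x => layer (g x) e k) by exact: layer_continuous.
have csum i : continuous (fun x => \sum_(k < i) layer (g x) e k).
  by apply: continuous_big => //; exact: add_continuous.
have -> : \int[mu]_(x in S) g x =
    \sum_(k < n.+1) \int[mu]_(x in S) layer (g x) e k.
  have := pfunct_sum Ipos (g := fun k x => layer (g x) e k) n.+1 cl.
  by move=> /= <-; exact: eq_Rintegral.
(* The bottom layer costs at most [e]. The others are compared after a shift by one: layer [k.+1] is
   at most [e] times the indicator of the set where [g] is at least [k.+1 * e]. On that set layer
   [k] equals [e], so its measure is at most [L] of layer [k] divided by [e]. *)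
rewrite big_ord_recl/= addrC.
apply: lerD; last first.
  rewrite -[leRHS](pfunct_cst Ipos); apply: (le_pfunct Ipos) => [||x Sx];
    [exact: cl|exact: cst_cont|].
  by rewrite /layer ge_min lexx orbT.
apply: (@le_trans _ _ (\sum_(k < n) L (fun x => layer (g x) e k))); last first.
  have := L_sum (g := fun k x => layer (g x) e k) n cl.
  move=> /= <-; apply: (le_pfunct Lpos) => [||x Sx]; [exact: csum|exact: cg|].
  by rewrite (sum_layer _ (g0 x Sx) e0) ge_min lexx.
apply: ler_sum => k _; rewrite /bump/= add1n.
pose A : set B := [set x | k.+1%:R * e <= g x].
have mA : measurable A.
  have := continuous_measurable_borel cg measurableT (measurable_itv `[k.+1%:R
    * e, +oo[).
  by rewrite setTI; congr measurable; apply/seteqP; split => x /=;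
    rewrite in_itv/= andbT.
have mS : measurable (S : set B) by exact: closed_measurable_borel.
have muA : (mu A <= (e^-1 * L (fun x => layer (g x) e k))%:E)%E.
  rewrite muE -LZ//; apply: riesz_outer_le.
  - by move=> x; apply: cvgM; [exact: cvg_cst|exact: cl].
  - by move=> x Sx; rewrite mulr_ge0// ?invr_ge0 ?layer_ge0// ltW.
  - move=> x Sx; rewrite /A/= -natr1 mulrDl mul1r => Ax.
    by rewrite ler_pdivlMl// mulr1 /layer le_min lexx le_max andbT; apply/orP;
      left; lra.
have iA : mu.-integrable S (EFin \o \1_A).
  apply: integrableS (integrable_indic _ mA) => //.
apply: (@le_trans _ _ (\int[mu]_(x in S) (e * \1_A x))).
  apply: le_Rintegral => //.
  - exact: integrable_continuous.
  - apply: (@integrableZl _ _ _ mu S mS e _ iA).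
  - move=> x Sx; rewrite indicE; have [_|xA] := boolP (x \in A).
      by rewrite mulr1 /layer ge_min lexx orbT.
    have {}xA : g x < k.+1%:R * e.
      by rewrite ltNge; apply: contra xA => xA; exact: mem_set.
    rewrite mulr0.
    by rewrite /layer ge_min ge_max lexx andbT; apply/orP; left; lra.
rewrite RintegralZl// -ler_pdivlMl// -lee_fin /Rintegral integral_indic// fineK.
  by rewrite (le_trans _ muA)// le_measure ?inE//; exact: measurableI.
by rewrite fin_num_measure//; exact: measurableI.
Qed.

End Riesz.

(** * Projection onto a box *)

Lemma le_mx_norm (R : realType) (n : nat) (x : 'rV[R]_n) (c : R) : 0 <= c ->
  (forall i, `|x 0 i| <= c) -> `|x| <= c.
Proof.
move=> c0 xc; rewrite /Num.norm/= mx_normrE.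
by apply/bigmax_leP; split => // -[i j] _ /=; rewrite ord1.
Qed.

Lemma coord_le_mx_norm (R : realType) (n : nat) (x : 'rV[R]_n) i :
  `|x 0 i| <= `|x|.
Proof.
rewrite [leRHS]/Num.norm/= mx_normrE.
by apply: (le_bigmax _ (fun ij : 'I_1 * 'I_n => `|x ij.1 ij.2|) (0, i)).
Qed.

Definition lipschitz_fun (R : realType) (V W : normedModType R)
    (M : R) (g : V -> W) := forall x y, `|g x - g y| <= M * `|x - y|.

Lemma lipschitz_fun_continuous (R : realType) (V W : normedModType R)
    (M : R) (g : V -> W) : lipschitz_fun M g -> continuous g.
Proof.
move=> gM x; apply/cvgrPdist_le => e e0.
have N0 : 0 < `|M| + 1 by rewrite ltr_wpDl.
near=> y; apply: (le_trans (gM x y));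
  apply: (@le_trans _ _ ((`|M| + 1) * `|x - y|)).
  by rewrite ler_wpM2r// (le_trans (ler_norm _))// lerDl.
rewrite -ler_pdivlMl//; near: y.
by apply: cvgr_dist_le => //; rewrite mulr_gt0 ?invr_gt0.
Unshelve. all: by end_near. Qed.

Section clamp.
Context (R : realType) (k : nat) (a b : 'rV[R]_k).
Hypothesis leab : forall i, a 0 i <= b 0 i.

(** The Euclidean projection onto the box, by [proj_on_box]. It also extends to the whole space the
    functions that are given on the box only. *)
Definition clamp (x : 'rV[R]_k) : 'rV[R]_k :=
  \row_i Num.max (a 0 i) (Num.min (b 0 i) (x 0 i)).

Lemma box_clamp x : box a b (clamp x).
Proof.
move=> i; rewrite mxE; move: (leab i) => ab.
by rewrite le_max lexx ge_max ab ge_min lexx.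
Qed.

Lemma clamp_id x : box a b x -> clamp x = x.
Proof.
move=> xS; apply/rowP => i; rewrite mxE; have /andP[ax xb] := xS i.
by rewrite min_r// max_r.
Qed.

Lemma clamp_lipschitz x y : `|clamp x - clamp y| <= `|x - y|.
Proof.
apply: le_mx_norm => // i; rewrite !mxE.
apply: le_trans (coord_le_mx_norm (x - y) i); rewrite !mxE.
move: (a 0 i) (b 0 i) (x 0 i) (y 0 i) => a' b' s t.
have h (c u v : R) : `|Num.max c u - Num.max c v| <= `|u - v|.
  have [?|?] := leP c u; have [?|?] := leP c v; rewrite ?subrr ?normr0//.
    rewrite !ger0_norm; lra.
  rewrite !ler0_norm; lra.
have h' (c u v : R) : `|Num.min c u - Num.min c v| <= `|u - v|.
  have [?|?] := leP c u; have [?|?] := leP c v; rewrite ?subrr ?normr0//.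
    rewrite !ger0_norm; lra.
  rewrite !ler0_norm; lra.
exact: le_trans (h _ _ _) (h' _ _ _).
Qed.

Lemma clamp_continuous : continuous clamp.
Proof.
apply: (@lipschitz_fun_continuous R _ _ 1) => x y; rewrite mul1r.
exact: clamp_lipschitz.
Qed.

Lemma compact_box : compact (box a b).
Proof.
have -> : box a b = [set v : 'rV[R]_k |
      forall i, `[a 0 i, b 0 i]%classic (v ord0 i)].
  by apply/seteqP; split => x h i; have := h i; rewrite /= in_itv.
apply: (@rV_compact R k (fun i => `[a 0 i, b 0 i]%classic)) => i.
exact: segment_compact.
Qed.

Lemma closed_box : closed (box a b).
Proof. exact: compact_closed (@norm_hausdorff _ _) compact_box. Qed.

(** The obtuse angle property of a projection, one coordinate at a time: with c the clamped
    coordinate, (x - c)(z - c) <= 0. It yields both the minimality of [clamp x] and its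
    uniqueness. *)
Let sqr_clamp_le (x z : 'rV[R]_k) i : box a b z ->
  (x - clamp x) 0 i ^+ 2 + (z - clamp x) 0 i ^+ 2 <= (x - z) 0 i ^+ 2.
Proof.
move=> zS; have /andP[az zb] := zS i; rewrite !mxE; move: az zb (leab i).
move: (a 0 i) (b 0 i) (x 0 i) (z 0 i) => a' b' s t az zb ab.
have [bs|sb] := leP b' s.
  by rewrite max_r//; nra.
by have [as_|sa] := leP a' s; nra.
Qed.

Lemma proj_on_box x : proj_on (box a b) x = clamp x.
Proof.
have near : nearest_point (box a b) x (clamp x).
  split=> [|z zS]; first exact: box_clamp.
  apply: ler_wsqrtr; apply: ler_sum => i _.
  by have := sqr_clamp_le x i zS; apply: le_trans; rewrite lerDl sqr_ge0.
(* [xget] returns some nearest point [y]. Summing [sqr_clamp_le] at [y] and using the minimality of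
   [y] leaves a sum of squares that is at most 0, hence [y = clamp x]. *)
rewrite /proj_on; case: xgetP => [y _ [yS ymin]|/(_ (clamp x))/(_ near)//].
have := ymin _ (box_clamp x).
rewrite /euclidean_norm ler_sqrt; last by apply: sumr_ge0 => i _;
  exact: sqr_ge0.
move=> le1.
have : \sum_i (y - clamp x) 0 i ^+ 2 <= 0.
  rewrite -(lerD2l (\sum_i (x - clamp x) 0 i ^+ 2)) addr0 -big_split/=.
  by apply: le_trans le1; apply: ler_sum => i _; exact: sqr_clamp_le.
move=> le0; apply/rowP => i; apply/eqP; rewrite -subr_eq0 -sqrf_eq0.
have /psumr_eq0P h : forall j, true -> 0 <= (y - clamp x) 0 j ^+ 2.
  by move=> j _; exact: sqr_ge0.
have := h _ i isT; rewrite !mxE => ->//.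
by apply/eqP; rewrite eq_le le0 sumr_ge0// => j _; exact: sqr_ge0.
Qed.

End clamp.

(** * Weak limits along ultrafilters *)

Lemma edist_le_norm (R : realType) (V : normedModType R) (x y : V) :
  (edist (x, y) <= `|x - y|%:E)%E.
Proof.
apply/lee_addgt0Pr => e e0; rewrite -EFinD; apply: edist_fin.
  by rewrite ltr_wpDl.
by rewrite -ball_normE /ball_/= ltrDl.
Qed.

Lemma open_cozero (R : realType) (V : normedModType R) (A : set V) : open A ->
  exists2 u : V -> R, lipschitz_fun 1 u &
    forall x, 0 <= u x /\ (A x <-> 0 < u x).
Proof.
(* [u] is the distance to the complement of [A]. If that complement is empty the distance is
   infinite, and the constant 1 is taken instead. *)
move=> oA; have [A0|/set0P[y0 Ay0]] := eqVneq (~` A) set0.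
  exists (fun=> 1) => [x y|x]; first by rewrite subrr normr0 mul1r.
  split => //; split => // _; apply: contrapT => Ax.
  by have : (~` A) x by []; rewrite A0.
have fin x : edist_inf (~` A) x \is a fin_num.
  rewrite ge0_fin_numE ?edist_inf_ge0//.
  apply: (le_lt_trans (edist_inf_triangle _ x y0)).
  rewrite (edist_inf0 Ay0) adde0.
  by rewrite (le_lt_trans (edist_le_norm x y0))// ltry.
exists (fine \o edist_inf (~` A)).
  have h x y : fine (edist_inf (~` A) x) - fine (edist_inf (~` A) y) <= `|x -
    y|.
    rewrite lerBlDr -lee_fin EFinD !fineK//.
    by rewrite (le_trans (edist_inf_triangle _ x y))// leeD2r// edist_le_norm.
  move=> x y; rewrite mul1r ler_norml h andbT lerNl opprB distrC; exact: h.
move=> x; split; first exact/fine_ge0/edist_inf_ge0.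
split => [Ax|].
  have /nbhs_ballP[r /= r0 xrA] : nbhs x A by exact: open_nbhs_nbhs.
  rewrite -lte_fin fineK//.
  apply: (@lt_le_trans _ _ r%:E); first by rewrite lte_fin.
  apply: le_ereal_inf_tmp => _ [y Ay <-]; rewrite leNgt.
  by apply/negP => /(@edist_lt_ball R V r (x, y))/xrA.
move=> h; apply: contrapT => Ax; move: h.
by rewrite /= edist_inf0// ltxx.
Qed.

(** Compactness gives a cluster point, and a cluster point of an ultrafilter is a limit, since every
    set or its complement belongs to the ultrafilter. *)
Lemma ultra_cvg_compact (I : Type) (T : topologicalType) (K : set T)
    (U : set_system I) (u : I -> T) :
  UltraFilter U -> compact K -> (\forall n \near U, K (u n)) ->
  exists2 p, K p & u @ U --> p.
Proof.
move=> UU cK uK; have [p [Kp clp]] := cK (u @ U) _ uK.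
exists p => // A Ap; have [//|nA] := in_ultra_setVsetC (u @^-1` A) UU.
by have [x [nAx Ax]] := clp (~` A) A nA Ap.
Qed.

(** The values [L n g] are eventually bounded, hence converge along [U], and the axioms of a
    positive functional pass to the limit. Functionals are taken instead of measures so as to cover
    the Cesaro means of Krylov-Bogoliubov as well. *)
Lemma weak_limit (R : realType) (k : nat) (S : set 'rV[R]_k)
    (L : nat -> ('rV[R]_k -> R) -> R) (U : set_system nat) :
  compact S -> UltraFilter U ->
  (\forall n \near U, positive_functional S (L n)) ->
  exists mu : probability (borel R k) R, mu S = 1%E /\
    forall g : 'rV[R]_k -> R, continuous g ->
      L n g @[n --> U] --> \int[mu]_(x in S) g x.
Proof.
move=> cS UU Lpos; have closedS := compact_closed (@norm_hausdorff _ _) cS.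
have cvgL (g : 'rV[R]_k -> R) : continuous g -> cvg (L n g @[n --> U]).
  move=> cg; have [M M0 gM] := bounded_continuous cS cg.
  have [|p _ Lp] := ultra_cvg_compact UU (@segment_compact R (- M) M)
      (u := fun n => L n g).
    near=> n; have Ln : positive_functional S (L n) by near: n.
    by rewrite /= in_itv /= -ler_norml; exact: (norm_pfunct_le Ln).
  exact: cvgP Lp.
pose L' g := lim (L n g @[n --> U]).
have L'pos : positive_functional S L'.
  split.
  - move=> g h cg ch; apply: cvg_lim => //.
    apply: (cvg_trans _ (cvgD (cvgL g cg) (cvgL h ch))).
    apply: near_eq_cvg; near=> n.
    by rewrite (@pfunctD _ _ S)//; near: n.
  - move=> c g cg; apply: cvg_lim => //.
    have h : c * L n g @[n --> U] --> c * L' g.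
      by apply: cvgM; [exact: cvg_cst|exact: cvgL].
    apply: (cvg_trans _ h).
    apply: near_eq_cvg; near=> n.
    by rewrite (@pfunctZ _ _ S)//; near: n.
  - move=> g cg g0; apply: limr_ge; first exact: cvgL.
    by near=> n; apply: (@pfunct_ge0 _ _ S) => //; near: n.
  - apply: cvg_lim => //; 
    have h : (fun=> 1 : R) @ U --> (1 : R) by exact: cvg_cst.
    apply: (cvg_trans _ h); apply: near_eq_cvg; near=> n.
    by rewrite (@pfunct_cst _ _ S)//; near: n.
have cozero (A : set 'rV[R]_k) : open A -> exists2 u : 'rV[R]_k -> R,
    continuous u & forall x, 0 <= u x /\ (A x <-> 0 < u x).
  move=> /open_cozero[u ulip uA]; exists u => //.
  exact: lipschitz_fun_continuous ulip.
have [mu [muS muL]] := riesz_representation cS cozero L'pos closedS.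
exists mu; split => // g cg; rewrite muL//; exact: cvgL.
Unshelve. all: by end_near. Qed.

(** * Feller operators and invariant probabilities *)

Lemma integrable_comp_bounded (R : realType) (k : nat) (S : set 'rV[R]_k)
    (d : measure_display) (E : measurableType d) (Q : probability E R)
    (w : E -> borel R k) (g : 'rV[R]_k -> R) :
  compact S -> measurable_fun [set: E] w -> (forall e, S (w e)) ->
  continuous g -> Q.-integrable [set: E] (fun e => (g (w e))%:E).
Proof.
move=> cS mw wS cg.
apply: (@measurable_bounded_integrable _ _ _ Q (g \o w)) => //.
- by rewrite ltey_eq fin_num_measure.
- exact: measurableT_comp (continuous_measurable_borel cg) mw.
- have [M M0 gM] := bounded_continuous cS cg.
  exists M; split; first exact: num_real.
  by move=> N MN x Sx; apply: (le_trans (gM _ (wS x))); exact: ltW.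
Qed.

Lemma positive_functional_comp (R : realType) (k : nat) (S : set 'rV[R]_k)
    (d : measure_display) (E : measurableType d) (Q : probability E R)
    (w : E -> borel R k) :
  compact S -> measurable_fun [set: E] w -> (forall e, S (w e)) ->
  positive_functional S (fun g : 'rV[R]_k -> R => \int[Q]_e g (w e)).
Proof.
move=> cS mw wS; split.
- by move=> g h cg ch; rewrite -RintegralD//;
    exact: (integrable_comp_bounded _ cS).
- by move=> c g cg; rewrite RintegralZl//;
    exact: (integrable_comp_bounded _ cS).
- by move=> g cg g0; apply: Rintegral_ge0 => e _; exact: g0.
- by rewrite Rintegral_cst// mul1r [X in fine X]probability_setT.
Qed.

(* The indicator of an open set {u > 0} is the limit of min(1, n u). *)
Lemma lipschitz_probability_unique (R : realType) (k : nat) (S : set 'rV[R]_k)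
    (mu nu : probability (borel R k) R) :
  compact S -> mu S = 1%E -> nu S = 1%E ->
  (forall (M : R) (g : 'rV[R]_k -> R), lipschitz_fun M g ->
    \int[mu]_(x in S) g x = \int[nu]_(x in S) g x) ->
  forall A : set (borel R k), measurable A -> mu A = nu A.
Proof.
move=> cS muS nuS eq_int.
have clS := compact_closed (@norm_hausdorff _ _) cS.
have mS : measurable (S : set (borel R k)) by exact: closed_measurable_borel.
(* Since [S] has full mass, integrals over [S] determine the measure of every Borel set. *)
have full (P : probability (borel R k) R) (A : set (borel R k)) :
    P S = 1%E -> measurable A -> P A = P (A `&` S).
  move=> PS mA; have P0 : P (~` S) = 0%E by rewrite probability_setC// PS subee.
  rewrite (measureDI _ mA mS) [X in (X + _)%E](_ : _ = 0%E) ?add0e//.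
  apply/eqP; rewrite eq_le measure_ge0 andbT -P0 le_measure ?inE//.
    exact: measurableD.
  exact: measurableC.
apply: (@measure_unique _ R (borel R k) (@open 'rV[R]_k) (fun=> setT) _ _ _ _
  mu nu) => //.
- exact: openI.
- by move=> _; exact: openT.
- by rewrite bigcup_const//; exists 0%N.
- move=> A oA.
  have mA : measurable (A : set (borel R k)) by exact: sub_sigma_algebra.
  have [u ulip uA] := open_cozero oA.
  pose h (n : nat) (x : 'rV[R]_k) : R := Num.min 1 (n%:R * u x).
  have hlip n : lipschitz_fun n%:R (h n).
    move=> x y; apply: (@le_trans _ _ `|n%:R * u x - n%:R * u y|).
      rewrite /h; have [?|?] := leP 1 (n%:R * u x);
        have [?|?] := leP 1 (n%:R * u y); rewrite ?subrr ?normr0//.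
        rewrite !ger0_norm; lra.
      rewrite !ler0_norm; lra.
    rewrite -mulrBr normrM normr_nat ler_wpM2l//.
    by rewrite (le_trans (ulip x y))// mul1r.
  have hcvg (P : probability (borel R k) R) : P S = 1%E ->
      (\int[P]_(x in S) (h n x)%:E)%E @[n --> \oo] --> P A.
    move=> PS; rewrite (full P A PS mA) -integral_indic//.
    apply: (@dominated_cvg _ _ _ P S mS _ _ (cst 1%E)) => //.
    + move=> n; apply/measurable_EFinP/measurable_funTS.
      apply: continuous_measurable_borel.
      exact: lipschitz_fun_continuous (hlip n).
    + move=> x Sx; apply: cvg_EFin; first by near=> n.
      rewrite indicE; have [xA|xA] := boolP (x \in (A : set (borel R k))).
        apply: cvg_near_cst; near=> n => /=.
        have [_ [/(_ (set_mem xA)) ux0 _]] := uA x.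
        rewrite /h min_l// -ler_pdivrMr// mul1r; near: n.
        exact: nbhs_infty_ger.
      have ux0 : u x = 0.
        have [u0 [_ uAx]] := uA x; apply/eqP; rewrite eq_le u0 andbT leNgt.
        by apply: contra xA => /uAx Ax; exact: mem_set.
      apply: cvg_near_cst; near=> n => /=.
      by rewrite /h ux0 mulr0 min_r.
    + exact: finite_measure_integrable_cst.
    + move=> n x Sx; rewrite lee_fin /h; have [u0 _] := uA x.
      by rewrite ger0_norm ?ge_min ?lexx// le_min ler01 mulr_ge0.
  have := hcvg mu muS; rewrite (_ : (fun n => _) = fun n => (\int[nu]_(x in S)
    (h n x)%:E)%E).
    move=> h1; have h2 := hcvg nu nuS.
    exact: (cvg_unique _ h1 h2).
  apply/funext => n.
  have ch : continuous (h n) by exact: lipschitz_fun_continuous (hlip n).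
  rewrite -[LHS]fineK ?integrable_fin_num//; last exact: integrable_continuous.
  rewrite -[RHS]fineK ?integrable_fin_num//; last exact: integrable_continuous.
  by congr EFin; exact: eq_int (hlip n).
- by move=> _; rewrite (le_lt_trans (probability_le1 _ _))// ltry.
Unshelve. all: by end_near. Qed.

(* [Psi] stands for (s, e) |-> psi (clamp s) e, which is defined everywhere. *)
Section markov_operator.
Context (R : realType) (k : nat) (S : set 'rV[R]_k)
  (d : measure_display) (E : measurableType d) (Q : probability E R)
  (Psi : 'rV[R]_k -> E -> 'rV[R]_k).
Hypothesis compactS : compact S.
Hypothesis mPsi : measurable_fun [set: borel R k * E]
  (fun x : borel R k * E => Psi x.1 x.2 : borel R k).
Hypothesis PsiS : forall s e, S (Psi s e).
Implicit Types (mu : probability (borel R k) R) (g : 'rV[R]_k -> R).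

Definition markov_op g (s : 'rV[R]_k) : R := \int[Q]_e g (Psi s e).

Hypothesis feller : forall g, continuous g -> continuous (markov_op g).

Let mS : measurable (S : set (borel R k)).
Proof.
exact: closed_measurable_borel (compact_closed (@norm_hausdorff _ _) compactS).
Qed.

Lemma measurable_markov_section (s : 'rV[R]_k) :
  measurable_fun [set: E] (fun e => Psi s e : borel R k).
Proof. exact: (measurable_fun_pair2 (s : borel R k) mPsi). Qed.

Lemma positive_functional_markov (s : 'rV[R]_k) :
  positive_functional S (markov_op^~ s).
Proof.
exact: positive_functional_comp compactS (measurable_markov_section s) (PsiS s).
Qed.

Let X : {mfun (borel R k * E)%type >-> borel R k} :=
  HB.pack (fun x : borel R k * E => Psi x.1 x.2 : borel R k)
    (isMeasurableFun.Build _ _ _ _ _ mPsi).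

(** [nu] is the law after one step of the chain started from [mu]: the image under [Psi] of the
    product of [mu] and [Q]. Sections of the product measure give the formula on sets, Fubini the
    one on functions. *)
Lemma markov_image mu : mu S = 1%E ->
  exists nu : probability (borel R k) R,
    [/\ nu S = 1%E,
      forall A : set (borel R k), measurable A ->
        nu A = (\int[mu]_(s in S) Q [set e | A (Psi s e)])%E &
      forall g, continuous g ->
        \int[nu]_(x in S) g x = \int[mu]_(x in S) markov_op g x].
Proof.
move=> muS.
have muC : mu (~` S) = 0%E by rewrite probability_setC// muS subee.
pose P : probability (borel R k * E)%type R := (mu \x Q)%E.
pose nu : probability (borel R k) R := distribution P X.
have XS : X @^-1` S = setT by apply/seteqP; split => x _ //; exact: PsiS.
exists nu; split.
- by rewrite -[RHS](probability_setT P) -XS.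
- move=> A mA; rewrite [LHS](_ : _ =
      (\int[mu]_s Q [set e | A (Psi s e)])%E); last first.
    apply: eq_integral => s _ /=; congr (Q _).
    by apply/seteqP; split => e /=; rewrite /xsection/= inE.
  rewrite (@ge0_negligible_integral _ _ _ mu setT (~` S))//.
  - by rewrite setTD setCK.
  - exact: measurableC.
  - have mXA : measurable (X @^-1` A).
      by rewrite -[X in measurable X]setTI; exact: mPsi.
    have := measurable_fun_xsection Q mXA; congr measurable_fun.
    apply/funext => s /=; congr (Q _).
    by apply/seteqP; split => e /=; rewrite /xsection/= inE.
- move=> g cg; have [M M0 gM] := bounded_continuous compactS cg.
  have mg := continuous_measurable_borel cg.
  have iP : P.-integrable setT (EFin \o (g \o X)).
    apply: integrable_comp_bounded compactS _ _ cg => //.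
    by move=> x; exact: PsiS.
  have iT : mu.-integrable setT (EFin \o markov_op g).
    apply: measurable_bounded_integrable => //.
    - by rewrite ltey_eq fin_num_measure.
    - by apply: continuous_measurable_borel; exact: feller.
    - exists M; split; first exact: num_real.
      move=> N MN s _; apply: (@le_trans _ _ M); last exact: ltW.
      exact: (norm_pfunct_le (positive_functional_markov s)).
  congr fine.
  rewrite (@integral_pushforward _ _ _ _ _ X _ P S (EFin \o g))//; last 2 first.
  - exact/measurable_EFinP.
  - by rewrite XS.
  rewrite XS -integral12_prod_meas1//.
  transitivity (\int[mu]_x (markov_op g x)%:E)%E.
    apply: eq_integral => s _; rewrite fineK//; apply: integrable_fin_num => //.
    apply: integrable_comp_bounded compactS _ _ cg => //.
    exact: measurable_markov_section.
  rewrite (@negligible_integral _ _ _ mu setT (~` S))//;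
    last exact: measurableC.
  by rewrite setTD setCK.
Qed.

Lemma markov_invariant_integral mu g : mu S = 1%E ->
  (forall A : set (borel R k), measurable A -> A `<=` S ->
    mu A = (\int[mu]_(s in S) Q [set e | A (Psi s e)])%E) ->
  continuous g -> \int[mu]_(x in S) g x = \int[mu]_(x in S) markov_op g x.
Proof.
move=> muS muA cg; have [nu [nuS nuA nug]] := markov_image muS.
rewrite -nug//; congr fine; apply: eq_measure_integral => A mA AS.
by apply: etrans (muA A mA AS) _; exact/esym/nuA.
Qed.

(** The law after one step has the same integrals as [mu] on Lipschitz functions, and these
    determine a probability carried by [S]. *)
Lemma markov_integral_invariant mu : mu S = 1%E ->
  (forall M g, lipschitz_fun M g ->
    \int[mu]_(x in S) g x = \int[mu]_(x in S) markov_op g x) ->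
  forall A : set (borel R k), measurable A ->
    mu A = (\int[mu]_(s in S) Q [set e | A (Psi s e)])%E.
Proof.
move=> muS mug A mA; have [nu [nuS nuA nug]] := markov_image muS.
apply: (etrans _ (nuA A mA));
  apply: (lipschitz_probability_unique compactS) => // M g glip.
rewrite (mug M)// nug//; exact: lipschitz_fun_continuous glip.
Qed.

Let iter_continuous n g : continuous g -> continuous (iter n markov_op g).
Proof. by move=> cg; elim: n => //= n ih; exact: feller. Qed.

(** The point [s] is taken in [S] because for [n = 0] the functional is evaluation at [s]. *)
Let positive_functional_iter n (s : 'rV[R]_k) : S s ->
  positive_functional S (fun g => iter n markov_op g s).
Proof.
elim: n s => [|n ih] s Ss.
  by split => //= g _; exact.
have Ls := positive_functional_markov s.
have L0 i x : S x -> positive_functional S (fun g => iter n markov_op g x).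
  exact: ih.
split => /=.
- move=> g h cg ch; rewrite -(pfunctD Ls); [|exact: iter_continuous..].
  apply: (eq_pfunct Ls) => [||x Sx].
  + by apply: iter_continuous; exact: continuous_addf.
  + by apply: continuous_addf; exact: iter_continuous.
  + by rewrite (pfunctD (ih x Sx)).
- move=> c g cg; rewrite -(pfunctZ Ls); last exact: iter_continuous.
  apply: (eq_pfunct Ls) => [||x Sx].
  + by apply: iter_continuous; exact: continuous_mull.
  + by apply: continuous_mull; exact: iter_continuous.
  + by rewrite (pfunctZ (ih x Sx)).
- move=> g cg g0; apply: (pfunct_ge0 Ls) => [|x Sx];
    first exact: iter_continuous.
  exact: (pfunct_ge0 (ih x Sx)).
- rewrite -[RHS](pfunct_cst Ls 1); apply: (eq_pfunct Ls) => [||x Sx].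
  + by apply: iter_continuous => x; exact: cst_continuous.
  + by move=> x; exact: cst_continuous.
  + by rewrite (pfunct_cst (ih x Sx)).
Qed.

(** The average of the laws, at times 0 to [n], of the chain started at [s], seen as a
    functional. *)
Let cesaro (s : 'rV[R]_k) n g : R :=
  n.+1%:R^-1 * \sum_(i < n.+1) iter i markov_op g s.

Let positive_functional_cesaro (s : 'rV[R]_k) n : S s ->
  positive_functional S (cesaro s n).
Proof.
move=> Ss; have Li i := positive_functional_iter i Ss.
split; rewrite /cesaro.
- move=> g h cg ch; rewrite -mulrDr -big_split/=; congr (_ * _).
  by apply: eq_bigr => i _; exact: (pfunctD (Li i)).
- move=> c g cg; rewrite mulrCA; congr (_ * _); rewrite mulr_sumr.
  by apply: eq_bigr => i _; exact: (pfunctZ (Li i)).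
- move=> g cg g0; rewrite mulr_ge0 ?invr_ge0// sumr_ge0// => i _.
  exact: (pfunct_ge0 (Li i)).
- rewrite (eq_bigr (fun=> 1)) => [|i _]; last exact: (pfunct_cst (Li i)).
  by rewrite big_const_ord iter_addr_0 mulVf// pnatr_eq0.
Qed.

Lemma krylov_bogoliubov : S !=set0 -> exists mu, mu S = 1%E /\
  forall A : set (borel R k), measurable A ->
    mu A = (\int[mu]_(s in S) Q [set e | A (Psi s e)])%E.
Proof.
move=> [s Ss]; have [U [UU ooU]] := ultraFilterLemma (F := \oo%classic) _.
have Lpos : \forall n \near U, positive_functional S (cesaro s n).
  by apply: nearW => n; exact: positive_functional_cesaro.
have [mu [muS muL]] := weak_limit compactS UU Lpos.
exists mu; split => //; apply: markov_integral_invariant => // M g glip.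
have cg : continuous g by exact: lipschitz_fun_continuous glip.
have [B B0 gB] := bounded_continuous compactS cg.
have cT := feller cg.
(* The averages of [markov_op g] and of [g] differ only by their extreme terms, hence by at most 2 B
   / (n + 1), so the limit gives both functions the same integral. *)
have telescope n : cesaro s n (markov_op g) - cesaro s n g =
    n.+1%:R^-1 * (iter n.+1 markov_op g s - g s).
  rewrite /cesaro -mulrBr -sumrB; congr (_ * _).
  rewrite -(big_mkord xpredT (fun i => iter i markov_op (markov_op g) s -
    iter i markov_op g s)).
  under eq_bigr do rewrite -iterSr.
  by rewrite telescope_sumr.
have cvg0 : (cesaro s n (markov_op g) - cesaro s n g) @[n --> U] --> (0 : R).
  apply: (@cvg_trans _ ((cesaro s n (markov_op g) - cesaro s n g) @[n -->
    \oo])).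
    by move=> A /ooU.
  apply/cvgr0Pnorm_le => e e0; near=> n; rewrite telescope normrM.
  rewrite ger0_norm ?invr_ge0// ler_pdivrMl//.
  have Ln := positive_functional_iter n.+1 Ss.
  have hB : `|iter n.+1 markov_op g s| <= B by exact: (norm_pfunct_le Ln).
  rewrite (le_trans (ler_normB _ _))// (le_trans (lerD hB (gB s Ss)))//.
  rewrite -ler_pdivrMr// (@le_trans _ _ n%:R) ?ler_nat//; near: n.
  exact: nbhs_infty_ger.
apply/eqP; rewrite eq_sym -subr_eq0; apply/eqP.
apply: (cvg_unique _ _ cvg0) => //.
exact: cvgB (muL _ cT) (muL _ cg).
Unshelve. all: by end_near. Qed.

End markov_operator.

(** * Extension of the transition maps to the whole space *)

Lemma continuous_measurable_borel_map (R : realType) (k n : nat)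
    (h : 'rV[R]_k -> 'rV[R]_n) : continuous h ->
  measurable_fun [set: borel R k] (h : borel R k -> borel R n).
Proof.
move=> /continuousP ch.
apply: (@measurability _ _ (borel R k) (borel R n) setT h (@open 'rV[R]_n)) =>
  //.
by move=> _ [V oV <-]; rewrite setTI; apply: sub_sigma_algebra; exact: ch.
Qed.

(** (A.3) speaks of sequences. If continuity fails for some [e], picking a bad point at distance
    less than 1 / (n + 1) for each [n] contradicts the hypothesis. *)
Lemma sequential_continuous (R : realType) (V : normedModType R) (h : V -> R)
    (x : V) :
  (forall u : nat -> V, u n @[n --> \oo] --> x ->
    h (u n) @[n --> \oo] --> h x) -> {for x, continuous h}.
Proof.
move=> hu; apply/cvgrPdist_lt => e e0; apply: contrapT => ne.
have bad n : exists y, `|x - y| < n.+1%:R^-1 /\ ~ `|h x - h y| < e.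
  apply: contrapT => /forallNP no; apply: ne.
  apply/nbhs_ballP; exists n.+1%:R^-1; first by rewrite /= invr_gt0.
  move=> y; rewrite -ball_normE /= => xy.
  by apply: contrapT => nxy; exact: (no y).
have [u uP] := choice bad.
have /hu/cvgrPdist_lt/(_ e e0)[N _ /(_ N (leqnn N))] : u n @[n --> \oo] --> x.
  apply/cvgrPdist_lt => r r0; near=> n; have [ux _] := uP n.
  apply: (lt_trans ux); near: n; exact: near_infty_natSinv_lt (PosNum r0).
by have [_] := uP N.
Unshelve. all: by end_near. Qed.

Section patch.
Context (R : realType) (k l : nat) (a b : 'rV[R]_k)
  (d : measure_display) (E : measurableType d) (Q : probability E R)
  (Theta : set 'rV[R]_l) (phi : 'rV[R]_k -> E -> 'rV[R]_l -> 'rV[R]_k).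
Hypothesis leab : forall i, a 0 i <= b 0 i.
Hypothesis compact_Theta : compact Theta.
Hypothesis phi_into : maps_into (box a b) Theta phi.
Hypothesis phi_A1 : assumption_A1 (box a b) Theta phi.

(** Agrees with [phi] on the box and takes its values in the box everywhere, so that its Markov
    operator can be evaluated at shifted points that leave the box. *)
Definition clamped (theta : 'rV[R]_l) (s : 'rV[R]_k) (e : E) : 'rV[R]_k :=
  phi (clamp a b s) e theta.

Lemma box_clamped theta s e : Theta theta -> box a b (clamped theta s e).
Proof. by move=> thetaT; apply: phi_into => //; exact: box_clamp. Qed.

Lemma measurable_clamped theta : Theta theta ->
  measurable_fun [set: borel R k * E]
    (fun x : borel R k * E => clamped theta x.1 x.2 : borel R k).
Proof.
move=> thetaT.
(* The composition rule below asks for a measurable domain; [Theta] is closed because it is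
   compact. *)
have mD : measurable
    (box a b `*` [set: E] `*` Theta : set (borel R k * E * borel R l)).
  apply: measurableX; first apply: measurableX => //.
    by apply: closed_measurable_borel; exact: closed_box.
  apply: closed_measurable_borel.
  exact: compact_closed (@norm_hausdorff _ _) compact_Theta.
apply: (@measurable_comp _ _ _ _ _ _
  (box a b `*` [set: E] `*` Theta : set (borel R k * E * borel R l))
  (fun x : borel R k * E * borel R l => phi x.1.1 x.1.2 x.2 : borel R k) setT
  (fun x : borel R k * E => ((clamp a b x.1 : borel R k, x.2), theta : borel R
    l))) => //.
- by move=> _ [x _ <-] /=; split => //; split => //; exact: box_clamp.
- apply: measurable_fun_pair => //; apply: measurable_fun_pair => //.
  apply: (@measurableT_comp _ _ _ _ _ _ (clamp a b : borel R k -> borel R k))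
    => //.
  apply: continuous_measurable_borel_map.
  exact: clamp_continuous.
Qed.

Lemma feller_clamped theta g : assumption_A3 Q (box a b) Theta phi ->
  Theta theta -> continuous g -> continuous (markov_op Q (clamped theta) g).
Proof.
move=> A3 thetaT cg s; apply: sequential_continuous => u us.
apply: (A3 theta thetaT g) => //.
- exact: continuous_subspaceT.
- by move=> i; exact: box_clamp.
- exact: box_clamp.
- apply: cvg_comp us _; exact: clamp_continuous.
Qed.

Lemma invariant_clampedP theta (mu : probability (borel R k) R) :
  invariant_probability Q (box a b) (fun s e => phi s e theta) mu <->
  mu (box a b) = 1%E /\ forall A : set (borel R k), measurable A ->
    A `<=` box a b ->
    mu A = (\int[mu]_(s in box a b) Q [set e | A (clamped theta s e)])%E.
Proof.
by split=> -[muS muA]; split => // A mA AS; rewrite muA//;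
  apply: eq_integral => s /set_mem sS; rewrite /clamped clamp_id.
Qed.

End patch.

(** * Perturbation estimates and increasing Lipschitz functions *)

Lemma measurable_mx_norm (R : realType) (k : nat) (d : measure_display)
    (E : measurableType d) (w : E -> 'rV[R]_k) :
  (forall i, measurable_fun [set: E] (fun e => w e 0 i)) ->
  measurable_fun [set: E] (fun e => `|w e|).
Proof.
move=> mw; rewrite (_ : (fun e => _) =
  fun e => \big[Num.max/0]_(ij : 'I_1 * 'I_k) `|w e ij.1 ij.2|); last first.
  by apply/funext => e; rewrite -mx_normrE.
elim: (index_enum _) => [|[i j] r ih].
  by rewrite (_ : (fun e => _) = cst 0)//; apply/funext => e; rewrite big_nil.
rewrite (_ : (fun e => _) = (fun e => Num.max `|w e i j|
  (\big[Num.max/0]_(ij <- r) `|w e ij.1 ij.2|))); last first.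
  by apply/funext => e; rewrite big_cons.
apply: measurable_maxr => //; apply: measurableT_comp => //.
by rewrite ord1; exact: mw.
Qed.

Lemma measurable_coord (R : realType) (k : nat) (d : measure_display)
    (E : measurableType d) (w : E -> borel R k) (i : 'I_k) :
  measurable_fun [set: E] w ->
  measurable_fun [set: E] (fun e => (w e : 'rV[R]_k) 0 i).
Proof.
move=> mw; apply: (@measurableT_comp _ _ _ _ _ _
  (fun x : borel R k => (x : 'rV[R]_k) 0 i)) => //.
by apply: continuous_measurable_borel => x; exact: coord_continuous.
Qed.

Section lipschitz_perturbation.
Context (R : realType) (k : nat) (S : set 'rV[R]_k)
  (d : measure_display) (E : measurableType d) (Q : probability E R).
Hypothesis compactS : compact S.
Variables (w1 w2 : E -> borel R k) (M : R) (g : 'rV[R]_k -> R).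
Hypotheses (mw1 : measurable_fun [set: E] w1)
  (mw2 : measurable_fun [set: E] w2).
Hypotheses (w1S : forall e, S (w1 e)) (w2S : forall e, S (w2 e)).
Hypotheses (M0 : 0 <= M) (glip : lipschitz_fun M g).

Let cg : continuous g := lipschitz_fun_continuous glip.
Let i1 := integrable_comp_bounded Q compactS mw1 w1S cg.
Let i2 := integrable_comp_bounded Q compactS mw2 w2S cg.

(** This turns the metric [dist_fun], a supremum of L1 distances, into a bound between Markov
    operators applied to a Lipschitz function. *)
Lemma le_Rintegral_L1_dist (c : R) :
  (\int[Q]_e `|(w1 e : 'rV[R]_k) - w2 e|%:E <= c%:E)%E ->
  `|\int[Q]_e g (w1 e) - \int[Q]_e g (w2 e)| <= M * c.
Proof.
move=> wc; rewrite -RintegralB// -lee_fin.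
have mdist : measurable_fun [set: E] (fun e => `|(w1 e : 'rV[R]_k) - w2 e|).
  apply: measurable_mx_norm => i.
  rewrite (_ : (fun e => _) =
      (fun e => (w1 e : 'rV[R]_k) 0 i - (w2 e : 'rV[R]_k) 0 i)); last first.
    by apply/funext => e; rewrite !mxE.
  by apply: measurable_funB; exact: measurable_coord.
have mdiff : measurable_fun [set: E] (fun e => g (w1 e) - g (w2 e)).
  apply: measurable_funB.
    exact/measurable_EFinP/(measurable_int _ i1).
  exact/measurable_EFinP/(measurable_int _ i2).
rewrite EFin_normr_Rintegral//; last exact: (integrableB measurableT i1 i2).
apply: (le_trans (le_abse_integral Q measurableT _)).
  exact/measurable_EFinP.
apply: (@le_trans _ _ (\int[Q]_e (M%:E * `|(w1 e : 'rV[R]_k) - w2 e|%:E))%E).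
  apply: ge0_le_integral => //.
  - by apply/measurableT_comp => //; exact/measurable_EFinP.
  - by apply: measurable_funeM; exact/measurable_EFinP.
  - by move=> e _; rewrite abse_EFin -EFinM lee_fin; exact: glip.
rewrite ge0_integralZl//; last exact/measurable_EFinP.
by rewrite EFinM lee_wpmul2l.
Qed.

Lemma le_Rintegral_sup_dist (c : R) :
  (forall e, g (w1 e) <= g (w2 e) + c) ->
  \int[Q]_e g (w1 e) <= \int[Q]_e g (w2 e) + c.
Proof.
move=> h.
have ic : Q.-integrable [set: E] (EFin \o cst c).
  exact: finite_measure_integrable_cst.
have -> : \int[Q]_e g (w2 e) + c = \int[Q]_e (g (w2 e) + c).
  rewrite RintegralD//= Rintegral_cst// [X in fine X]probability_setT.
  by rewrite mulr1.
apply: le_Rintegral => //; exact: (integrableD measurableT i2 ic).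
Qed.

End lipschitz_perturbation.

Lemma norm_const_mx_le (R : realType) (k : nat) (c : R) :
  `|const_mx c : 'rV[R]_k| <= `|c|.
Proof. by apply: le_mx_norm => // i; rewrite mxE. Qed.

Lemma shift_continuous (R : realType) (k : nat) (c : R) :
  continuous (fun x : 'rV[R]_k => x + const_mx c).
Proof.
apply: (@lipschitz_fun_continuous R _ _ 1) => x y.
by rewrite opprD addrACA subrr addr0 mul1r.
Qed.

(** Dominated convergence. The bound on [h] is global because the shifted points may leave [S]. *)
Lemma cvg_integral_shift (R : realType) (k : nat) (S : set 'rV[R]_k)
    (mu : probability (borel R k) R) (h : 'rV[R]_k -> R) (B : R)
    (c : nat -> R) :
  compact S -> continuous h -> (forall x, `|h x| <= B) ->
  c m @[m --> \oo] --> 0 ->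
  \int[mu]_(x in S) h (x + const_mx (c m)) @[m --> \oo] -->
    \int[mu]_(x in S) h x.
Proof.
move=> cS ch hB c0.
have mS : measurable (S : set (borel R k)).
  exact: closed_measurable_borel (compact_closed (@norm_hausdorff _ _) cS).
have cshift (r : R) : continuous (fun x : 'rV[R]_k => h (x + const_mx r)).
  by move=> x; exact: continuous_comp (@shift_continuous _ _ r x) (ch _).
apply: fine_cvg; rewrite fineK; last first.
  apply: integrable_fin_num => //.
  exact: (integrable_continuous _ cS (compact_closed (@norm_hausdorff _ _) cS)).
apply: (@dominated_cvg _ _ _ mu S mS _ _ (cst B%:E)) => //.
- move=> m; apply/measurable_EFinP/measurable_funTS.
  exact: continuous_measurable_borel.
- move=> x Sx; apply: cvg_EFin; first by near=> m.
  have xc : x + const_mx (c m) @[m --> \oo] --> x.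
    apply/cvgrPdist_le => e e0; near=> m;
      rewrite opprD addrA subrr sub0r normrN.
    rewrite (le_trans (norm_const_mx_le _ _))//.
    by near: m; move/cvgr0Pnorm_le : c0; exact.
  exact: cvg_comp xc (ch x).
- exact: finite_measure_integrable_cst.
- by move=> m x Sx; rewrite lee_fin.
Unshelve. all: by end_near. Qed.

(* With s |-> M (s_1 + ... + s_k) added, an M-Lipschitz function becomes
   increasing. *)
Lemma lipschitz_sub_increasing (R : realType) (k : nat) (M : R)
    (g : 'rV[R]_k -> R) : lipschitz_fun M g ->
  exists M' g1 g2, [/\ g = g1 \- g2, 0 <= M',
    lipschitz_fun M' g1 /\ lipschitz_fun M' g2,
    forall s s', vle s' s -> g1 s' <= g1 s &
    forall s s', vle s' s -> g2 s' <= g2 s].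
Proof.
move=> glip; pose N := `|M|; have N0 : 0 <= N by exact: normr_ge0.
have gN x y : `|g x - g y| <= N * `|x - y|.
  by rewrite (le_trans (glip x y))// ler_wpM2r// ler_norm.
pose g2 (s : 'rV[R]_k) := N * \sum_i s 0 i.
have g2lip x y : `|g2 x - g2 y| <= N * k%:R * `|x - y|.
  rewrite -mulrBr normrM normr_id -mulrA ler_wpM2l// -sumrB.
  rewrite (le_trans (ler_norm_sum _ _ _))//.
  apply: (@le_trans _ _ (\sum_(i < k) `|x - y|)).
    apply: ler_sum => i _; apply: le_trans (coord_le_mx_norm (x - y) i).
    by rewrite !mxE.
  by rewrite sumr_const card_ord mulr_natl.
exists (N + N * k%:R), (g \+ g2), g2; split.
- by apply/funext => s /=; rewrite addrK.
- by rewrite addr_ge0// mulr_ge0.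
- split=> x y.
    rewrite /= opprD addrACA mulrDl (le_trans (ler_normD _ _))//.
    by rewrite lerD// gN.
  by rewrite (le_trans (g2lip x y))// ler_wpM2r// lerDr.
- move=> s s' ss' /=.
  (* For [s'] below [s], the max norm of [s' - s] is at most the sum of the nonnegative numbers
     [s 0 i - s' 0 i], so the increase of [g2] compensates any decrease of [g]. *)
  have : g s' - g s <= N * (\sum_i s 0 i - \sum_i s' 0 i).
    rewrite (le_trans (ler_norm _))// (le_trans (gN s' s))// ler_wpM2l// -sumrB.
    apply: le_mx_norm; first by apply: sumr_ge0 => i _; rewrite subr_ge0.
    move=> i; rewrite !mxE ler0_norm ?subr_le0// opprB (bigD1 i)//= lerDl.
    by apply: sumr_ge0 => j _; rewrite subr_ge0.
  by rewrite /g2 mulrBr; lra.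
- by move=> s s' ss'; rewrite ler_wpM2l// ler_sum.
Qed.

(** * Limits of invariant probabilities *)

Section closed_graph.
Context (R : realType) (k l : nat) (a b : 'rV[R]_k)
  (d : measure_display) (E : measurableType d) (Q : probability E R)
  (Theta : set 'rV[R]_l) (phi : 'rV[R]_k -> E -> 'rV[R]_l -> 'rV[R]_k).
Hypothesis leab : forall i, a 0 i <= b 0 i.
Hypothesis compact_Theta : compact Theta.
Hypothesis phi_into : maps_into (box a b) Theta phi.
Hypothesis phi_A1 : assumption_A1 (box a b) Theta phi.
Local Notation S := (box a b).
Local Notation T := (fun phi theta => markov_op Q (clamped a b phi theta)).

Let cS : compact S := @compact_box R k a b.

Lemma markov_dist_le (psi : 'rV[R]_k -> E -> 'rV[R]_l -> 'rV[R]_k)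
    theta (c M : R) (g : 'rV[R]_k -> R) s :
  maps_into S Theta psi -> assumption_A1 S Theta psi -> Theta theta ->
  (dist_fun Q S (fun s e => psi s e theta) (fun s e => phi s e theta)
    <= c%:E)%E ->
  0 <= M -> lipschitz_fun M g ->
  `|T psi theta g s - T phi theta g s| <= M * c.
Proof.
move=> psi_into psi_A1 thetaT dc M0 glip.
apply: (le_Rintegral_L1_dist cS) => //.
- exact: (measurable_markov_section
    (measurable_clamped leab compact_Theta psi_A1 thetaT)).
- exact: (measurable_markov_section
    (measurable_clamped leab compact_Theta phi_A1 thetaT)).
- by move=> e; exact: (box_clamped leab psi_into).
- by move=> e; exact: (box_clamped leab phi_into).
- apply: le_trans dc; apply: ereal_sup_ubound.
  by exists (clamp a b s) => //; exact: box_clamp.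
Qed.

(** Monotonicity of [g] carries the order relations of (A.4) over to the integrals. The outer shift
    and projection cost at most [M * c], as the projection is 1-Lipschitz and fixes [S]. The inner
    shift is kept in the argument of the operator, where [clamped] already performs the
    projection. *)
Lemma markov_sandwich theta theta' (c M : R) (g : 'rV[R]_k -> R) s :
  Theta theta -> Theta theta' -> 0 <= c ->
  fun_le S (fun s e => phi s e theta')
           (fun s e => phi_up S phi c s e theta) ->
  fun_le S (fun s e => phi_down S phi c s e theta)
           (fun s e => phi s e theta') ->
  0 <= M -> lipschitz_fun M g ->
  (forall s s', vle s' s -> g s' <= g s) -> S s ->
  T phi theta' g s <= T phi theta g (s + const_mx c) + M * c /\
  T phi theta g (s + const_mx (- c)) <= T phi theta' g s + M * c.
Proof.
move=> thetaT thetaT' c0 up down M0 glip ginc sS.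
have mT t x : Theta t ->
    measurable_fun [set: E] (fun e => clamped a b phi t x e : borel R k).
  by move=> tT; exact: (measurable_markov_section
    (measurable_clamped leab compact_Theta phi_A1 tT)).
have inS t x e : Theta t -> S (clamped a b phi t x e).
  by move=> tT; exact: (box_clamped leab phi_into).
have shift (r : R) (y : 'rV[R]_k) : `|r| <= c -> S y ->
    `|g (clamp a b (y + const_mx r)) - g y| <= M * c.
  move=> rc yS; rewrite (le_trans (glip _ _))// ler_wpM2l//.
  rewrite -{2}(clamp_id yS) (le_trans (clamp_lipschitz _ _ _ _))//.
  by rewrite addrAC subrr add0r (le_trans (norm_const_mx_le _ _)).
split; rewrite /markov_op;
  apply: (@le_Rintegral_sup_dist _ _ S _ _ Q cS _ _ M g) => //; try exact: mT;
    try (by move=> e; exact: inS).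
- move=> e; have := up s e sS; rewrite /phi_up !proj_on_box// => /ginc.
  rewrite {1}/clamped (clamp_id sS) => /le_trans; apply.
  rewrite -lerBlDl; apply: (le_trans (ler_norm _)); apply: shift;
    last exact: inS.
  by rewrite ger0_norm.
- have constN : const_mx (- c) = - const_mx c :> 'rV[R]_k.
    by apply/rowP => i; rewrite !mxE.
  move=> e; have := down s e sS;
    rewrite /phi_down !proj_on_box// -constN => /ginc.
  rewrite {2}/clamped (clamp_id sS) -(lerD2r (M * c)); apply: le_trans.
  rewrite -lerBlDl; apply: (le_trans (ler_norm _)); rewrite distrC.
  by apply: shift; [rewrite normrN ger0_norm|exact: inS].
Qed.

Hypothesis phi_A3 : assumption_A3 Q S Theta phi.
Hypothesis phi_A4 : assumption_A4 S Theta phi.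
Variables (phij : nat -> 'rV[R]_k -> E -> 'rV[R]_l -> 'rV[R]_k)
  (U : set_system nat) (thetaj : nat -> 'rV[R]_l) (theta : 'rV[R]_l)
  (nu : nat -> probability (borel R k) R).
Hypothesis ultraU : UltraFilter U.
Hypothesis phijP : \forall j \near U, [/\ maps_into S Theta (phij j),
  assumption_A1 S Theta (phij j), assumption_A3 Q S Theta (phij j) &
  Theta (thetaj j)].
Hypothesis phij_cvg : forall c : R, 0 < c -> \forall j \near U,
  (dist_fun Q S (fun s e => phij j s e (thetaj j))
    (fun s e => phi s e (thetaj j)) <= c%:E)%E.
Hypothesis thetaT : Theta theta.
Hypothesis thetaj_cvg : thetaj j @[j --> U] --> theta.
Hypothesis nu_invariant : \forall j \near U,
  invariant_probability Q S (fun s e => phij j s e (thetaj j)) (nu j).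

Let closedS : closed S := @closed_box R k a b.

Section limit.
Variable mu : probability (borel R k) R.
Hypothesis muS : mu S = 1%E.
Hypothesis nu_mu : forall g : 'rV[R]_k -> R, continuous g ->
  \int[nu j]_(x in S) g x @[j --> U] --> \int[mu]_(x in S) g x.

(** One [M * c] comes from (A.4), the other from the distance between [phij j] and [phi] at
    [thetaj j]. The operator in the bounds is that of [phi] at the fixed [theta], so its integrals
    pass to the limit. *)
Lemma limit_sandwich (M c : R) (g : 'rV[R]_k -> R) : 0 < c -> 0 <= M ->
  lipschitz_fun M g -> (forall s s', vle s' s -> g s' <= g s) ->
  \int[mu]_(x in S) g x <=
    \int[mu]_(x in S) T phi theta g (x + const_mx c) + M * c *+ 2 /\
  \int[mu]_(x in S) T phi theta g (x + const_mx (- c)) <=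
    \int[mu]_(x in S) g x + M * c *+ 2.
Proof.
move=> c0 M0 glip ginc.
have cg : continuous g := lipschitz_fun_continuous glip.
have cT : continuous (T phi theta g) := feller_clamped leab phi_A3 thetaT cg.
have cTs r : continuous (fun x : 'rV[R]_k => T phi theta g (x + const_mx r)).
  by move=> x; exact: continuous_comp (@shift_continuous _ _ r x) (cT _).
have cstc : continuous (fun _ : 'rV[R]_k => M * c *+ 2).
  by move=> x; exact: cst_continuous.
have key : \forall j \near U,
    \int[nu j]_(x in S) g x <=
      \int[nu j]_(x in S) T phi theta g (x + const_mx c) + M * c *+ 2 /\
    \int[nu j]_(x in S) T phi theta g (x + const_mx (- c)) <=
      \int[nu j]_(x in S) g x + M * c *+ 2.
  (* (A.4) is used at the limit point [theta]; convergence brings [thetaj j] into its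
     neighborhood. *)
  have [V [oV Vtheta VTheta]] := phi_A4 thetaT c0.
  have Vj : \forall j \near U, V (thetaj j).
    by apply: thetaj_cvg; exact: open_nbhs_nbhs.
  near=> j.
  have [pinto pA1 pA3 tT] : [/\ maps_into S Theta (phij j),
      assumption_A1 S Theta (phij j), assumption_A3 Q S Theta (phij j) &
      Theta (thetaj j)] by near: j.
  have [|_ [up down]] := VTheta (thetaj j); first by split => //; near: j.
  have /(invariant_clampedP _ _ _) [nuS nuA] :
      invariant_probability Q S (fun s e => phij j s e (thetaj j)) (nu j).
    by near: j.
  have Ipos := positive_functional_integral cS closedS nuS.
  have cTj : continuous (T (phij j) (thetaj j) g) :=
    feller_clamped leab pA3 tT cg.
  (* Invariance trades [g] for its image under the operator of [phij j], which can be compared with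
     that of [phi]. *)
  have -> : \int[nu j]_(x in S) g x =
      \int[nu j]_(x in S) T (phij j) (thetaj j) g x.
    apply: (markov_invariant_integral cS) => //.
    - exact: (measurable_clamped leab compact_Theta pA1 tT).
    - by move=> s e; exact: (box_clamped leab pinto).
    - by move=> h ch; exact: (feller_clamped leab pA3 tT ch).
  have bound x : S x ->
      T (phij j) (thetaj j) g x <= T phi theta g (x + const_mx c) + M * c *+ 2
        /\
      T phi theta g (x + const_mx (- c)) <= T (phij j) (thetaj j) g x + M * c
        *+ 2.
    move=> xS.
    have [h1 h2] := markov_sandwich thetaT tT (ltW c0) up down M0 glip ginc xS.
    have : `|T (phij j) (thetaj j) g x - T phi (thetaj j) g x| <= M * c.
      apply: markov_dist_le => //.
      by near: j; exact: phij_cvg.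
    by rewrite ler_norml => /andP[h3 h4]; split; lra.
  rewrite -{1 2}(pfunct_cst Ipos (M * c *+ 2)) -!(pfunctD Ipos)//.
  split; apply: (le_pfunct Ipos) => [||x xS].
  - exact: cTj.
  - exact: continuous_addf.
  - by have [] := bound x xS.
  - exact: cTs.
  - exact: continuous_addf.
  - by have [] := bound x xS.
split.
- apply: (@ler_cvg_to _ U _ _ (fun j => \int[nu j]_(x in S) g x)
    (fun j => \int[nu j]_(x in S) T phi theta g (x + const_mx c) + M * c *+ 2)).
  + exact: nu_mu.
  + by apply: cvgD; [exact: nu_mu (cTs c)|exact: cvg_cst].
  + by apply: filterS key => j [].
- apply: (@ler_cvg_to _ U _ _
    (fun j => \int[nu j]_(x in S) T phi theta g (x + const_mx (- c)))
    (fun j => \int[nu j]_(x in S) g x + M * c *+ 2)).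
  + exact: nu_mu (cTs (- c)).
  + by apply: cvgD; [exact: nu_mu|exact: cvg_cst].
  + by apply: filterS key => j [].
Unshelve. all: by end_near. Qed.

Let cvg_invn : (n.+1%:R^-1 : R) @[n --> \oo] --> 0 := @cvg_harmonic R.

Let cvg_error (M : R) : (M * n.+1%:R^-1 *+ 2 : R) @[n --> \oo] --> 0.
Proof.
rewrite (_ : 0 = M * 0 *+ 2); last by rewrite mulr0 mul0rn.
by apply: cvgMn; apply: cvgM; [exact: cvg_cst|exact: cvg_invn].
Qed.

Lemma limit_increasing (M : R) (g : 'rV[R]_k -> R) : 0 <= M ->
  lipschitz_fun M g -> (forall s s', vle s' s -> g s' <= g s) ->
  \int[mu]_(x in S) g x = \int[mu]_(x in S) T phi theta g x.
Proof.
move=> M0 glip ginc.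
have cg : continuous g := lipschitz_fun_continuous glip.
have cT : continuous (T phi theta g) := feller_clamped leab phi_A3 thetaT cg.
have [B B0 gB] := bounded_continuous cS cg.
(* The bound holds outside [S] too, since [clamped] always lands in [S]; the shifts by 1 / (n + 1)
   below require this. *)
have TB x : `|T phi theta g x| <= B.
  apply: (norm_pfunct_le (positive_functional_markov Q cS
    (measurable_clamped leab compact_Theta phi_A1 thetaT) _ x)) => //.
  by move=> s e; exact: (box_clamped leab phi_into).
have n0 n : 0 < n.+1%:R^-1 :> R by rewrite invr_gt0.
apply/eqP; rewrite eq_le; apply/andP; split.
- apply: (@ler_cvg_to _ \oo _ _ (fun=> \int[mu]_(x in S) g x)
    (fun n => \int[mu]_(x in S) T phi theta g (x + const_mx n.+1%:R^-1) +
      M * n.+1%:R^-1 *+ 2)).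
  + exact: cvg_cst.
  + rewrite -[X in _ --> X]addr0; apply: cvgD; last exact: cvg_error.
    exact: (@cvg_integral_shift _ _ S mu (T phi theta g) B (fun n =>
      n.+1%:R^-1)).
  + by apply: nearW => n; have [] := limit_sandwich (n0 n) M0 glip ginc.
- apply: (@ler_cvg_to _ \oo _ _
    (fun n => \int[mu]_(x in S) T phi theta g (x + const_mx (- n.+1%:R^-1)))
    (fun n => \int[mu]_(x in S) g x + M * n.+1%:R^-1 *+ 2)).
  + apply: (@cvg_integral_shift _ _ S mu (T phi theta g) B (fun n => -
      n.+1%:R^-1)) => //.
    by rewrite -[X in _ --> X]oppr0; apply: cvgN; exact: cvg_invn.
  + by rewrite -[X in _ --> X]addr0; apply: cvgD;
      [exact: cvg_cst|exact: cvg_error].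
  + by apply: nearW => n; have [] := limit_sandwich (n0 n) M0 glip ginc.
Qed.

Lemma limit_invariant :
  invariant_probability Q S (fun s e => phi s e theta) mu.
Proof.
have mT := measurable_clamped leab compact_Theta phi_A1 thetaT.
have inS s e : S (clamped a b phi theta s e) by exact: (box_clamped leab
  phi_into).
have fT g (cg : continuous g) : continuous (T phi theta g) :=
  feller_clamped leab phi_A3 thetaT cg.
apply/(invariant_clampedP a b Q phi theta mu); split => // A mA _.
apply: (markov_integral_invariant cS mT inS fT muS) mA => M g glip.
have [M' [g1 [g2 [-> M0 [lip1 lip2] inc1 inc2]]]] := lipschitz_sub_increasing
  glip.
have c1 : continuous g1 := lipschitz_fun_continuous lip1.
have c2 : continuous g2 := lipschitz_fun_continuous lip2.
have Ipos := positive_functional_integral cS closedS muS.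
rewrite (pfunctB Ipos c1 c2) (limit_increasing M0 lip1 inc1).
rewrite (limit_increasing M0 lip2 inc2) -(pfunctB Ipos (fT _ c1) (fT _ c2)).
congr Rintegral; apply/funext => s.
exact: (esym (pfunctB (positive_functional_markov Q cS mT inS s) c1 c2)).
Qed.

End limit.

(** Some weak limit of [nu] along [U] exists and is invariant by [limit_invariant]; (A.5) identifies
    it with [mu]. *)
Lemma cvg_invariant_integral (mu : probability (borel R k) R)
    (g : 'rV[R]_k -> R) :
  assumption_A5 Q S Theta phi ->
  invariant_probability Q S (fun s e => phi s e theta) mu ->
  continuous g ->
  \int[nu j]_(x in S) g x @[j --> U] --> \int[mu]_(x in S) g x.
Proof.
move=> A5 mu_inv cg.
have nupos : \forall j \near U,
    positive_functional S (fun h => \int[nu j]_(x in S) h x).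
  apply: filterS nu_invariant => j [nuS _].
  exact: positive_functional_integral.
have [mu' [muS mu'L]] := weak_limit cS ultraU nupos.
have mu'_inv := limit_invariant muS mu'L.
have [mu0 [_ uniq]] := A5 theta thetaT.
have -> : \int[mu]_(x in S) g x = \int[mu']_(x in S) g x.
  congr fine; apply: eq_measure_integral => A mA _.
  by apply: etrans (uniq _ mu_inv A mA) _; exact/esym/(uniq _ mu'_inv A mA).
exact: mu'L.
Qed.

End closed_graph.

(** * Convergence of the minimizers *)

(** If the preimage of a neighborhood of [p] is not in [F], then [F] together with its complement
    generates a proper filter, and an ultrafilter containing that filter contradicts the
    hypothesis. *)
Lemma cvg_ultra (I : Type) (T : topologicalType) (F : set_system I)
    (u : I -> T) (p : T) : Filter F ->
  (forall U : set_system I, UltraFilter U -> F `<=` U -> u @ U --> p) ->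
  u @ F --> p.
Proof.
move=> FF Up A Ap; apply: contrapT => nFA.
have {}nFA : ~ F (u @^-1` A) by [].
have [U [UU FU]] : exists U, UltraFilter U /\ within (~` (u @^-1` A)) F `<=` U.
  apply: ultraFilterLemma; apply: Build_ProperFilter_ex => B;
    rewrite /within /= => FB.
  apply: contrapT => nB; apply: nFA; apply: filterS FB => i Bi.
  by apply: contrapT => nAi; apply: nB; exists i; exact: Bi.
have UA : U (u @^-1` A).
  by apply: (Up U UU _ A Ap) => B FB; apply: FU; apply: filterS FB => i Bi _.
have UnA : U (~` (u @^-1` A)).
  by apply: (FU (~` (u @^-1` A))); apply: (@filterS _ F _ setT) => //;
    exact: filterT.
by have [i []] := filter_ex (filterI UA UnA).
Qed.

(** An explicit Tietze extension of [f] from the box, needed because weak convergence is tested on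
    functions continuous on the whole space. *)
Lemma continuous_comp_clamp (R : realType) (k p : nat) (a b : 'rV[R]_k)
    (f : 'rV[R]_k -> 'rV[R]_p) : (forall i, a 0 i <= b 0 i) ->
  {within box a b, continuous f} -> continuous (f \o clamp a b).
Proof.
move=> leab cf x A Af.
have [V Vx VA] := (nbhs_subspace_ex _ (box_clamp leab x)).1 (cf (clamp a b x) A
  Af).
have cV : nbhs x (clamp a b @^-1` V) by exact: clamp_continuous Vx.
apply: filterS cV => y Vy.
by have [] : (f @^-1` A `&` box a b) (clamp a b y)
  by rewrite VA; split => //; exact: box_clamp.
Qed.

Lemma cvg_vintegral (R : realType) (k p : nat) (a b : 'rV[R]_k)
    (f : 'rV[R]_k -> 'rV[R]_p) (U : set_system nat)
    (nu : nat -> probability (borel R k) R) (mu : probability (borel R k) R) :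
  Filter U -> (forall i, a 0 i <= b 0 i) -> {within box a b, continuous f} ->
  (forall g : 'rV[R]_k -> R, continuous g ->
    \int[nu j]_(x in box a b) g x @[j --> U] --> \int[mu]_(x in box a b) g x) ->
  vintegral (box a b) (nu j) f @[j --> U] --> vintegral (box a b) mu f.
Proof.
move=> FU leab cf nu_mu; apply/cvgrPdist_le => e e0.
have coord (P : probability (borel R k) R) i : vintegral (box a b) P f 0 i =
    \int[P]_(x in box a b) f (clamp a b x) 0 i.
  rewrite mxE; apply: eq_Rintegral => x /set_mem xS.
  by rewrite clamp_id.
have near_coord : \forall j \near U, forall i,
    `|vintegral (box a b) mu f 0 i - vintegral (box a b) (nu j) f 0 i| <= e.
  apply: filter_forall => i.
  have : continuous (fun x => f (clamp a b x) 0 i).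
    move=> x; have cfx := @continuous_comp_clamp _ _ _ _ _ f leab cf x.
    exact: continuous_comp cfx (@coord_continuous _ _ _ 0 i _).
  move=> /nu_mu/cvgrPdist_le/(_ e e0); apply: filterS => j.
  by rewrite !coord.
apply: filterS near_coord => j nj; apply: le_mx_norm; first exact: ltW.
by move=> i; have := nj i; rewrite !mxE.
Qed.

Unset Implicit Arguments.

Theorem theorem4p5 (R : realType) (k l p : nat)
  (a b : 'rV[R]_k) (ltab : forall i, a 0 i < b 0 i)
  (d : measure_display) (E : measurableType d) (Q : probability E R)
  (Theta : set 'rV[R]_l) (compact_Theta : compact Theta)
  (f : 'rV[R]_k -> 'rV[R]_p)
  (f_continuous : {within box a b, continuous f})
  (f_increasing : increasing_on (box a b) f)
  (G : 'rV[R]_p -> 'rV[R]_p -> R)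
  (G_continuous : continuous (fun x : 'rV[R]_p * 'rV[R]_p => G x.1 x.2))
  (fbar : 'rV[R]_p)
  (phi : 'rV[R]_k -> E -> 'rV[R]_l -> 'rV[R]_k)
  (phi_into : maps_into (box a b) Theta phi)
  (phi_A1 : assumption_A1 (box a b) Theta phi)
  (phi_A3 : assumption_A3 Q (box a b) Theta phi)
  (phi_A4 : assumption_A4 (box a b) Theta phi)
  (phi_A5 : assumption_A5 Q (box a b) Theta phi)
  (mu : 'rV[R]_l -> probability (borel R k) R)
  (mu_invariant : forall theta, Theta theta ->
    invariant_probability Q (box a b) (fun s e => phi s e theta) (mu theta))
  (theta0 : 'rV[R]_l)
  (theta0_min : is_unique_minimizer Theta
    (fun theta => G (vintegral (box a b) (mu theta) f) fbar) theta0)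
  (phij : nat -> 'rV[R]_k -> E -> 'rV[R]_l -> 'rV[R]_k)
  (phij_into : forall j, (1 <= j)%N -> maps_into (box a b) Theta (phij j))
  (phij_A1 : forall j, (1 <= j)%N -> assumption_A1 (box a b) Theta (phij j))
  (phij_A3 : forall j, (1 <= j)%N -> assumption_A3 Q (box a b) Theta (phij j))
  (phij_cvg :
    ereal_sup [set dist_fun Q (box a b)
                 (fun s e => phij j s e theta) (fun s e => phi s e theta)
              | theta in Theta] @[j --> \oo] --> 0%E)
  (thetaj : nat -> 'rV[R]_l)
  (thetaj_optimal : forall j, (1 <= j)%N ->
    optimal_solution Q (box a b) Theta f G fbar (phij j) (thetaj j)) :
  thetaj j @[j --> \oo] --> theta0.
Proof.
have leab i : a 0 i <= b 0 i by exact: ltW.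
have [[theta0T theta0_le] theta0_uniq] := theta0_min.
apply: cvg_ultra => U UU ooU.
have near1 : \forall j \near U, (1 <= j)%N.
  by apply: ooU; exact: nbhs_infty_ge.
have thetajT j : (1 <= j)%N -> Theta (thetaj j).
  by move=> /thetaj_optimal[].
(* By compactness of [Theta] the sequence has a limit along [U]; it remains to see that this limit
   minimizes the limit problem. *)
have [thetas thetasT cvg_thetas] : exists2 t, Theta t & thetaj j @[j --> U] -->
  t.
  apply: ultra_cvg_compact => //.
  by apply: filterS near1 => j; exact: thetajT.
suff <- : thetas = theta0 by [].
(* Uniformity over [Theta] matters here: the bound is used at the moving points [thetaj j]. *)
have phij_near (c : R) : 0 < c -> \forall j \near U, forall t, Theta t ->
    (dist_fun Q (box a b) (fun s e => phij j s e t) (fun s e => phi s e t)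
      <= c%:E)%E.
  move=> c0; apply: ooU.
  have c0n : nbhs (0%E : \bar R) [set y | (y < c%:E)%E].
    by apply: open_nbhs_nbhs; split;
      [exact: open_ereal_lt_ereal|rewrite /= lte_fin].
  have : \forall j \near \oo, (ereal_sup [set dist_fun Q (box a b)
      (fun s e => phij j s e t) (fun s e => phi s e t) | t in Theta] < c%:E)%E.
    exact: phij_cvg c0n.
  apply: filterS => j hj t tT.
  by apply: le_trans (ltW hj); apply: ereal_sup_ubound; exists t.
(* [nu j] is the invariant probability that attains the optimum. The hypotheses start at [j = 1], so
   at index 0 an arbitrary probability is taken. *)
have /choice[nu nuP] j : exists nuj : probability (borel R k) R, (1 <= j)%N ->
    invariant_probability Q (box a b) (fun s e => phij j s e (thetaj j)) nuj /\
    forall t (mu' : probability (borel R k) R), Theta t ->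
      invariant_probability Q (box a b) (fun s e => phij j s e t) mu' ->
      G (vintegral (box a b) nuj f) fbar <= G (vintegral (box a b) mu' f) fbar.
  have [->|j1] := posnP j; first by exists (mu theta0).
  by have [_ [nuj ?]] := thetaj_optimal j j1; exists nuj.
(* [eta j] is the competitor in the [j]-th problem: an invariant probability at [theta0], provided
   by Krylov-Bogoliubov. *)
have /choice[eta etaP] j : exists etaj : probability (borel R k) R,
    (1 <= j)%N ->
    invariant_probability Q (box a b) (fun s e => phij j s e theta0) etaj.
  have [->|j1] := posnP j; first by exists (mu theta0).
  have pinto := phij_into j j1; have pA1 := phij_A1 j j1.
  have [||||eta [etaS etaA]] := @krylov_bogoliubov R k (box a b) d E Q
    (clamped a b (phij j) theta0) (@compact_box R k a b).
  - exact: (measurable_clamped leab compact_Theta pA1 theta0T).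
  - by move=> s e; exact: (box_clamped leab pinto).
  - by move=> g cg; exact: (feller_clamped leab (phij_A3 j j1) theta0T cg).
  - by exists (clamp a b a); exact: box_clamp.
  - exists eta => _; apply/(invariant_clampedP a b Q (phij j) theta0 eta);
      split => // A mA _.
    exact: etaA.
have phijP t : (forall j, (1 <= j)%N -> Theta (t j)) -> \forall j \near U,
    [/\ maps_into (box a b) Theta (phij j),
      assumption_A1 (box a b) Theta (phij j),
      assumption_A3 Q (box a b) Theta (phij j) & Theta (t j)].
  by move=> tT; apply: filterS near1 => j j1; split;
    [exact: phij_into|exact: phij_A1|exact: phij_A3|exact: tT].
(* Stated for any parameters and invariant probabilities, as it serves for both [thetaj] with [nu]
   and the constant [theta0] with [eta]. *)
have limit (t : nat -> 'rV[R]_l) theta (xi : nat -> probability (borel R k) R) :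
    (forall j, (1 <= j)%N -> Theta (t j)) -> Theta theta ->
    t j @[j --> U] --> theta ->
    (forall j, (1 <= j)%N ->
      invariant_probability Q (box a b) (fun s e => phij j s e (t j)) (xi j)) ->
    G (vintegral (box a b) (xi j) f) fbar @[j --> U] -->
      G (vintegral (box a b) (mu theta) f) fbar.
  move=> tT thetaT cvg_t xi_inv.
  have cvg_xi : vintegral (box a b) (xi j) f @[j --> U] -->
      vintegral (box a b) (mu theta) f.
    apply: cvg_vintegral => // g cg.
    apply: (cvg_invariant_integral leab compact_Theta phi_into phi_A1 phi_A3
      phi_A4 UU (phijP t tT) _ thetaT cvg_t) => //.
    - move=> c c0; near=> j.
      have cj : forall t, Theta t -> (dist_fun Q (box a b)
        (fun s e => phij j s e t) (fun s e => phi s e t) <= c%:E)%E.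
        by near: j; exact: phij_near.
      by apply: cj; apply: tT; near: j.
    - by apply: filterS near1 => j; exact: xi_inv.
    - exact: mu_invariant.
  have cvg_pair_xi : (vintegral (box a b) (xi j) f, fbar) @[j --> U] -->
      (vintegral (box a b) (mu theta) f, fbar).
    exact: (cvg_pair cvg_xi (cvg_cst fbar)).
  exact: (cvg_comp _ _ cvg_pair_xi
    (G_continuous (vintegral (box a b) (mu theta) f, fbar))).
(* It is enough to compare [thetas] with [theta0]: optimality gives the inequality between [nu j]
   and [eta j] for each [j >= 1], and it passes to the limit along [U]. *)
apply: theta0_uniq; split => // t tT; apply: le_trans (theta0_le t tT).
apply: (@ler_cvg_to _ U _ _ (fun j => G (vintegral (box a b) (nu j) f) fbar)
  (fun j => G (vintegral (box a b) (eta j) f) fbar)).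
- by apply: (limit thetaj) => // j /nuP[].
- by apply: (limit (fun=> theta0)) => //; exact: cvg_cst.
- by apply: filterS near1 => j j1; have [_ h] := nuP j j1;
    exact: h theta0T (etaP j j1).
Unshelve. all: by end_near. Qed.
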